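(* Consider the one-sided reflecting random leap on $\{0,1,2,\dots\}$. If $\mu\ge0$, it has no stationary distribution. If $\mu<0$, then the series $\sum_{j=0}^\infty\det(\boldsymbol\Omega_j)$ converges to a finite nonzero number and the (unique) stationary distribution $\boldsymbol\pi=(\pi_0,\pi_1,\dots)$ is \[ \pi_i=\frac{\det(\boldsymbol\Omega_i)}{\sum_{j=0}^\infty\det(\boldsymbol\Omega_j)},\qquad i\in\{0,1,\dots\}. \]
   Context: Fix an integer $k\ge1$ and nonnegative reals $p_1,\dots,p_k,q_1,\dots,q_k$ with $\sum_{j=1}^k(p_j+q_j)=1$, $\sum_{j=1}^k p_j>0$, $\sum_{j=1}^k q_j>0$, and $\gcd\{j:p_j+q_j>0\}=1$. Let $k_p=\max\{j:p_j>0\}$, $k_q=\max\{j:q_j>0\}$, $r=k_p+k_q-1$, $\mu=\sum_{j=1}^k j(p_j-q_j)$. Let $\xi$ be a random variable with $P(\xi=\ell)=p_\ell$, $P(\xi=-\ell)=q_\ell$ ($1\le\ell\le k$). The one-sided reflecting random leap is the Markov chain on $\{0,1,\dots\}$ with $P(i\to0)=P(i+\xi\le0)$ and $P(i\to j)=P(i+\xi=j)$ for $j\ge1$. Reverse characteristic polynomial: $\psi(z)=\sum_{j=0}^{2k-1}\gamma_jz^j$, $\gamma_j=-\sum_{\ell=k-j}^k p_\ell$ for $0\le j\le k-1$, $\gamma_j=\sum_{\ell=j-k+1}^k q_\ell$ for $k\le j\le 2k-1$; it has exactly $r$ nonzero roots counted with multiplicity. Let $y_1,\dots,y_s$ be its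 distinct nonzero roots listed in ascending order of absolute value (ties broken arbitrarily), with multiplicities $r_1,\dots,r_s$. For each $j$ let $\mathbf Y^{(j)}_\infty$ be the matrix with rows indexed by $i=1,2,\dots$ and $r_j$ columns, with entries $(i+1-k_p)^{\ell-1}y_j^{\,i+1-k_p}$ ($0^0=1$), and let $\boldsymbol\Psi$ be the matrix with infinitely many rows consisting of the first $k_p$ columns of $(\mathbf Y^{(1)}_\infty\ \cdots\ \mathbf Y^{(s)}_\infty)$. Half-accordion matrix: for $i\ge0$, $\mathbf H_i$ is the matrix with $k_p$ rows and infinitely many columns $\begin{pmatrix}I_{k_p-1}&0&0&\cdots\\0&\mathbf 1_i^T&0&\cdots\end{pmatrix}$ (i.e. its first $k_p-1$ rows are the first $k_p-1$ unit row vectors, and its last row has ones exactly in columns $k_p,\dots,k_p+i-1$). Let $\boldsymbol\eta_\infty$ be the infinite vector with $\eta_j=\sum_{\ell=j-k_p+1}^{k_q}(\ell-j+k_p)q_\ell$ for $k_p\le j\le r$ and $\eta_j=0$ otherwise. For $i\ge0$ let $\boldsymbol\Omega_i=\begin{pmatrix}\mathbf H_i\boldsymbol\Psi&\mathbf e_{k_p-1}-\mathbf e_{k_p}\\ \boldsymbol\eta_\infty^T\boldsymbol\Psi & \sum_{\ell=1}^{k_p}p_\ell-\sum_{\ell=1}^{k_q}\ell q_\ell\end{pmatrix}$, a $(k_p+1)\times(k_p+1)$ matrix, where $\mathbf e_m$ is the $m$-th unit vector of length $k_p$ and $\mathbf e_{k_p-1}=\mathbf 0$ if $k_p=1$. 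*)

(* Defs.v *)
From Stdlib Require Import Reals ZArith Arith Lia.
Open Scope R_scope.

Definition Cplx : Type := (R * R)%type.
Definition RtoC (x : R) : Cplx := (x, 0).
Definition C0 : Cplx := (0, 0).
Definition C1 : Cplx := (1, 0).
Definition Cadd (u v : Cplx) : Cplx := (fst u + fst v, snd u + snd v).
Definition Copp (u : Cplx) : Cplx := (- fst u, - snd u).
Definition Csub (u v : Cplx) : Cplx := Cadd u (Copp v).
Definition Cmul (u v : Cplx) : Cplx :=
  (fst u * fst v - snd u * snd v, fst u * snd v + snd u * fst v).
Definition Cinv (u : Cplx) : Cplx :=
  (fst u / (fst u ^ 2 + snd u ^ 2), - snd u / (fst u ^ 2 + snd u ^ 2)).
Definition Cdiv (u v : Cplx) : Cplx := Cmul u (Cinv v).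
Definition Cmod (u : Cplx) : R := sqrt (fst u ^ 2 + snd u ^ 2).
Fixpoint Cpow (u : Cplx) (n : nat) : Cplx :=
  match n with O => C1 | S m => Cmul u (Cpow u m) end.
(* integer powers (used only with nonzero base when the exponent is negative) *)
Definition Cpowz (u : Cplx) (n : Z) : Cplx :=
  match n with
  | Z0 => C1
  | Zpos m => Cpow u (Pos.to_nat m)
  | Zneg m => Cpow (Cinv u) (Pos.to_nat m)
  end.

Fixpoint sumRn (n : nat) (f : nat -> R) : R :=
  match n with O => 0 | S m => sumRn m f + f m end.
(* sumR a b f = sum_{j=a}^{b} f j  (empty if b < a) *)
Definition sumR (a b : nat) (f : nat -> R) : R :=
  sumRn (S b - a) (fun t => f (a + t)%nat).
Fixpoint sumCn (n : nat) (f : nat -> Cplx) : Cplx :=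
  match n with O => C0 | S m => Cadd (sumCn m f) (f m) end.
Definition sumC (a b : nat) (f : nat -> Cplx) : Cplx :=
  sumCn (S b - a) (fun t => f (a + t)%nat).
Fixpoint prodCn (n : nat) (f : nat -> Cplx) : Cplx :=
  match n with O => C1 | S m => Cmul (prodCn m f) (f m) end.

Definition Cseries_cv (a : nat -> Cplx) (L : Cplx) : Prop :=
  forall eps : R, eps > 0 -> exists N : nat, forall n : nat, (n >= N)%nat ->
    Cmod (Csub (sumCn (S n) a) L) < eps.

(* determinant of the n x n matrix (M a b)_{0<=a,b<n}, by cofactor (Laplace)
   expansion along the first row *)
Fixpoint detC (n : nat) (M : nat -> nat -> Cplx) : Cplx :=
  match n with
  | O => C1
  | S m => sumCn (S m) (fun c =>
      Cmul (Cmul (Cpow (Copp C1) c) (M O c))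
           (detC m (fun a b => M (S a) (if (b <? c)%nat then b else S b))))
  end.

Definition is_last_pos (k : nat) (p : nat -> R) (n : nat) : Prop :=
  (1 <= n <= k)%nat /\ 0 < p n /\ (forall j, (n < j <= k)%nat -> ~ (0 < p j)).

Definition drift (k : nat) (p q : nat -> R) : R :=
  sumR 1 k (fun j => INR j * (p j - q j)).

Definition Pxi (k : nat) (p q : nat -> R) (z : Z) : R :=
  if (0 <? z)%Z then (if (z <=? Z.of_nat k)%Z then p (Z.to_nat z) else 0)
  else if (z <? 0)%Z then (if (- z <=? Z.of_nat k)%Z then q (Z.to_nat (- z)) else 0)
  else 0.

Definition trans (k : nat) (p q : nat -> R) (i j : nat) : R :=
  match j with
  | O => (* P(i + xi <= 0) = sum over z in [-k, k] with i + z <= 0 *)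
      sumR 0 (2 * k) (fun t =>
        let z := (Z.of_nat t - Z.of_nat k)%Z in
        if (Z.of_nat i + z <=? 0)%Z then Pxi k p q z else 0)
  | S _ => Pxi k p q (Z.of_nat j - Z.of_nat i)
  end.

Definition stationary (k : nat) (p q : nat -> R) (pi : nat -> R) : Prop :=
  (forall i, 0 <= pi i) /\ infinite_sum pi 1 /\
  (forall j, infinite_sum (fun i => pi i * trans k p q i j) (pi j)).

Definition gamma (k : nat) (p q : nat -> R) (j : nat) : R :=
  if (j <=? k - 1)%nat then - sumR (k - j) k p
  else sumR (j - k + 1) k q.

Definition psi (k : nat) (p q : nat -> R) (z : Cplx) : Cplx :=
  sumC 0 (2 * k - 1) (fun j => Cmul (RtoC (gamma k p q j)) (Cpow z j)).

(* y_0, ..., y_{s-1} (0-based) are the distinct nonzero roots of psi,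
   in ascending order of modulus, with multiplicities rr 0, ..., rr (s-1) *)
Definition root_listing (k : nat) (p q : nat -> R)
    (s : nat) (y : nat -> Cplx) (rr : nat -> nat) : Prop :=
  (forall j, (j < s)%nat -> y j <> C0) /\
  (forall j, (j < s)%nat -> (1 <= rr j)%nat) /\
  (forall i j, (i < s)%nat -> (j < s)%nat -> i <> j -> y i <> y j) /\
  (forall i j, (i <= j)%nat -> (j < s)%nat -> Cmod (y i) <= Cmod (y j)) /\
  (exists (c : Cplx) (m : nat), c <> C0 /\
     forall z : Cplx, psi k p q z =
       Cmul (Cmul c (Cpow z m)) (prodCn s (fun j => Cpow (Csub z (y j)) (rr j)))).

(* entry (row i >= 1, column l = c+1) of Y^{(j)}_infty:
   (i+1-kp)^(l-1) * y^(i+1-kp) *)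
Definition Yentry (kp : nat) (yj : Cplx) (i c : nat) : Cplx :=
  let e := (Z.of_nat i + 1 - Z.of_nat kp)%Z in
  Cmul (Cpow (RtoC (IZR e)) c) (Cpowz yj e).

(* column c (0-based) of the concatenation (Y^{(j0)} ... Y^{(s-1)}) at row i *)
Fixpoint concat_col (kp : nat) (y : nat -> Cplx) (rr : nat -> nat)
    (fuel j c i : nat) : Cplx :=
  match fuel with
  | O => C0
  | S f => if (c <? rr j)%nat then Yentry kp (y j) i c
           else concat_col kp y rr f (S j) (c - rr j) i
  end.

(* Psi: rows i = 1, 2, ...; columns c = 0 .. kp-1 (0-based) *)
Definition Psi (kp s : nat) (y : nat -> Cplx) (rr : nat -> nat) (i c : nat) : Cplx :=
  concat_col kp y rr s O c i.

Definition eta (kp kq : nat) (q : nat -> R) (j : nat) : R :=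
  if andb (kp <=? j)%nat (j <=? kp + kq - 1)%nat then
    sumR (j - kp + 1) kq (fun l => (INR l - INR j + INR kp) * q l)
  else 0.

(* Omega_i as a (kp+1) x (kp+1) matrix with 0-based indices a, b *)
Definition Omega (k : nat) (p q : nat -> R) (kp kq s : nat) (y : nat -> Cplx)
    (rr : nat -> nat) (i : nat) (a b : nat) : Cplx :=
  let PS := Psi kp s y rr in
  if (a <? kp)%nat then
    if (b <? kp)%nat then
      (* row a+1 of H_i Psi *)
      if (a + 1 <? kp)%nat then PS (a + 1)%nat b
      else sumC kp (kp + i - 1) (fun t => PS t b)   (* empty when i = 0 *)
    else
      (* column e_{kp-1} - e_kp *)
      if (a + 2 =? kp)%nat then C1
      else if (a + 1 =? kp)%nat then Copp C1 else C0
  else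
    if (b <? kp)%nat then
      sumC kp (kp + kq - 1) (fun j => Cmul (RtoC (eta kp kq q j)) (PS j b))
    else RtoC (sumR 1 kp p - sumR 1 kq (fun l => INR l * q l)).

(* Main.v *)
(** Extend a sequence [x] on [{0, 1, ...}] by zero to the left and let [d] be its
    difference sequence. Invariance at every state [n >= 1] says that [d] satisfies
    the linear recurrence with characteristic polynomial [psi]; invariance at [0]
    says that no mass flows across the edge of [0], and this is the last row of
    [Omega].

    If [drift < 0], a maximum principle for harmonic functions shows that at most
    [kq - 1] roots of [psi] lie outside the open unit disc, so the first [kp] columns
    of [Psi] decay geometrically. Hence a vector annihilated by all rows of [Omega]
    but the [kp]-th one is a geometrically decaying complex invariant sequence [x],
    and the [kp]-th row of [Omega i] evaluates it at [i]. An invariant sequence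
    tending to zero has an invariant absolute value, so it vanishes as soon as
    [x 0 = 0]. Therefore [det (Omega 0) <> 0], and Cramer's rule for matrices
    differing in a single row gives [det (Omega i) = x i * det (Omega 0)] for the
    invariant sequence with [x 0 = 1], which is nonnegative.

    If [drift >= 0], testing invariance against the truncated function [N - i]
    forces the mass at [0] to vanish. *)

(* The obstacle is to locate the roots of [psi]: some could a priori lie on the unit circle, with
   multiplicity, and ties in modulus are broken arbitrarily. No contour is used. Reading a solution
   of the recurrence backwards turns invariance into harmonicity for the walk, and a root of modulus
   at least 1 into a function of at most polynomial growth. Comparison with [z ^ (-n)], which is
   strictly superharmonic for some [z] slightly below 1 because the drift is negative, beats that
   growth; what remains is a dimension count, valid for every admissible order of the roots.

   Passing to differences removes the root 1 from the jump equation [(z - 1) psi(z) = 0], so that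
   the columns in use decay. The price is a constant of integration, and its vanishing uses the
   nonzero drift a second time.

   No determinant is evaluated: the invertibility of [Omega 0] is a uniqueness statement about the
   chain. As the roots are complex, the lemmas on real sequences are applied to real and imaginary
   parts separately. *)
From Stdlib Require Import Reals ZArith Arith Lia Lra.
From Coquelicot Require Import Hierarchy Rcomplements Lim_seq Series.
From Coquelicot Require Complex.
From HB Require structures.
From mathcomp Require all_boot all_algebra ring boolp.
Require Import Defs.
Open Scope R_scope.

(** * Linear algebra and exponential polynomials over the complex numbers *)

(* The entries of the blocks of [Psi], at the integer [e = i + 1 - kp]. *)
Definition polyexp (y : Cplx) (c : nat) (e : Z) : Cplx :=
  Cmul (Cpow (RtoC (IZR e)) c) (Cpowz y e).

Lemma Cadd_assoc (u v w : Cplx) : Cadd u (Cadd v w) = Cadd (Cadd u v) w.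
Proof. unfold Cadd; simpl; f_equal; ring. Qed.
Lemma Cadd_comm (u v : Cplx) : Cadd u v = Cadd v u.
Proof. unfold Cadd; simpl; f_equal; ring. Qed.
Lemma Cadd_0_l (u : Cplx) : Cadd C0 u = u.
Proof. destruct u; unfold Cadd, C0; simpl; f_equal; ring. Qed.
Lemma Cadd_opp_l (u : Cplx) : Cadd (Copp u) u = C0.
Proof. unfold Cadd, Copp, C0; simpl; f_equal; ring. Qed.
Lemma Cmul_assoc (u v w : Cplx) : Cmul u (Cmul v w) = Cmul (Cmul u v) w.
Proof. unfold Cmul; simpl; f_equal; ring. Qed.
Lemma Cmul_comm (u v : Cplx) : Cmul u v = Cmul v u.
Proof. unfold Cmul; simpl; f_equal; ring. Qed.
Lemma Cmul_1_l (u : Cplx) : Cmul C1 u = u.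
Proof. destruct u; unfold Cmul, C1; simpl; f_equal; ring. Qed.
Lemma Cmul_add_l (u v w : Cplx) : Cmul (Cadd u v) w = Cadd (Cmul u w) (Cmul v w).
Proof. unfold Cmul, Cadd; simpl; f_equal; ring. Qed.
Lemma C1_neq_C0 : C1 <> C0.
Proof. unfold C1, C0; intros H; injection H; lra. Qed.
Lemma Cinv_l (u : Cplx) : u <> C0 -> Cmul (Cinv u) u = C1.
Proof.
  intros Hu; destruct u as [a b].
  assert (a * a + b * b <> 0).
  { intros H; apply Hu; unfold C0; f_equal; nra. }
  unfold Cmul, Cinv, C1; simpl; f_equal; field; lra.
Qed.
(** The field interface asks for 0 as the inverse of 0; both numerators in [Cinv] vanish there,
    whatever [/ 0] is. *)
Lemma Cinv_0 : Cinv C0 = C0.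
Proof. unfold Cinv, C0; simpl; f_equal; unfold Rdiv; ring. Qed.

Lemma Cpowz_succ (y : Cplx) (A : Z) :
  y <> C0 -> Cpowz y (A + 1) = Cmul y (Cpowz y A).
Proof.
  intros Hy; destruct A as [|m|m].
  - reflexivity.
  - simpl; rewrite Pos.add_1_r, Pos2Nat.inj_succ; reflexivity.
  - destruct (Pos.eq_dec m 1) as [->|Hm].
    + simpl; rewrite Cmul_assoc, (Cmul_comm y), Cinv_l, Cmul_1_l; auto.
    + replace (Z.neg m + 1)%Z with (Z.neg (Pos.pred m)) by lia.
      rewrite <- (Pos.succ_pred m Hm) at 2; simpl.
      rewrite Pos2Nat.inj_succ; simpl.
      rewrite Cmul_assoc, (Cmul_comm y), Cinv_l, Cmul_1_l; auto.
Qed.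

Lemma Cpowz_add_nat (y : Cplx) (A : Z) (t : nat) :
  y <> C0 -> Cpowz y (A + Z.of_nat t) = Cmul (Cpowz y A) (Cpow y t).
Proof.
  intros Hy; induction t as [|t IH].
  - rewrite Z.add_0_r, Cmul_comm; symmetry; apply Cmul_1_l.
  - rewrite Nat2Z.inj_succ, <- Z.add_1_r, Z.add_assoc, Cpowz_succ, IH by exact Hy.
    simpl; rewrite !Cmul_assoc, (Cmul_comm y); reflexivity.
Qed.

Fixpoint sumNn (n : nat) (f : nat -> nat) : nat :=
  match n with O => O | S m => (sumNn m f + f m)%nat end.

(** * The complex numbers as a MathComp field *)

Module CplxAlgebra.
Import HB.structures mathcomp.boot.all_boot mathcomp.algebra.all_algebra.
Import mathcomp.algebra_tactics.ring.
Import GRing.Theory.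
Set Implicit Arguments.
Unset Strict Implicit.
Unset Printing Implicit Defensive.
Local Open Scope ring_scope.

(** Equality of reals is not computable; the equality test and the choice operator are the classical
    ones of [boolp]. *)
HB.instance Definition _ := boolp.gen_eqMixin Cplx.
HB.instance Definition _ := boolp.gen_choiceMixin Cplx.
HB.instance Definition _ :=
  GRing.isZmodule.Build Cplx Cadd_assoc Cadd_comm Cadd_0_l Cadd_opp_l.
Fact Cplx_one_neq0 : (C1 : Cplx) != 0.
Proof. apply/eqP; exact: C1_neq_C0. Qed.
HB.instance Definition _ :=
  GRing.Zmodule_isComNzRing.Build Cplx Cmul_assoc Cmul_comm Cmul_1_l Cmul_add_l
    Cplx_one_neq0.
Fact Cplx_mulVf (u : Cplx) : u != 0 -> Cinv u * u = 1.
Proof. move/eqP; exact: Cinv_l. Qed.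
HB.instance Definition _ :=
  GRing.ComNzRing_isField.Build Cplx Cplx_mulVf Cinv_0.

Lemma CmulE (u v : Cplx) : Cmul u v = u * v.
Proof. by []. Qed.

Lemma sumCnE n (f : nat -> Cplx) : sumCn n f = \sum_(i < n) f i.
Proof. by elim: n => [|n IH]; rewrite ?big_ord0 // big_ord_recr /= IH. Qed.

Lemma prodCnE n (f : nat -> Cplx) : prodCn n f = \prod_(i < n) f i.
Proof. by elim: n => [|n IH]; rewrite ?big_ord0 // big_ord_recr /= IH. Qed.

Lemma CpowE u n : Cpow u n = u ^+ n.
Proof. by elim: n => [|n IH] //=; rewrite exprS IH. Qed.

Lemma natCE n : (n%:R : Cplx) = RtoC (INR n).
Proof.
elim: n => [//|n IH]; rewrite -addn1 natrD IH addn1 S_INR.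
by congr pair; rewrite /= Rplus_0_r.
Qed.

Lemma natC_inj : injective (fun n => n%:R : Cplx).
Proof. by move=> m n; rewrite !natCE => -[/INR_eq]. Qed.

Lemma natC_eq0 n : ((n%:R : Cplx) == 0) = (n == 0%N).
Proof. exact: (inj_eq natC_inj n 0%N). Qed.

Lemma detCE n (M : nat -> nat -> Cplx) : detC n M = \det (\matrix_(i < n, j < n) M i j).
Proof.
elim: n M => [|n IH] M; first by rewrite det_mx00.
rewrite (expand_det_row _ ord0) [LHS]sumCnE; apply: eq_bigr => c _.
rewrite mxE /cofactor add0n CpowE.
transitivity ((-1) ^+ c * M 0%N c *
    detC n (fun a b => M a.+1 (if Nat.ltb b c then b else b.+1))); first by [].
rewrite IH [_ * M 0%N c]mulrC -mulrA.
congr (_ * (_ * \det _)); apply/matrixP => i j; rewrite !mxE.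
congr (M _ _); rewrite /= /bump.
case: (Nat.ltb_spec j c) => [/ssrnat.ltP|/ssrnat.leP -> //].
by rewrite ltnNge => /negbTE ->.
Qed.

(** * The Euler operator and independence of exponential polynomials *)

(** The Euler operator [X d/dX] conjugated by [X ^ N]: it multiplies the coefficient of index [t] by
    [N + t]. With [N] the image of an integer [A], possibly negative, it produces the factors
    [A + t] of [polyexp] without Laurent polynomials. *)
Definition theta (F : comNzRingType) (N : F) (P : {poly F}) := 'X * P^`() + N *: P.

Lemma coef_iter_theta (F : comNzRingType) (N : F) c (P : {poly F}) t :
  (iter c (theta N) P)`_t = (N + t%:R) ^+ c * P`_t.
Proof.
elim: c => [|c IH]; first by rewrite mul1r.
rewrite iterS exprS -mulrA -IH coefD coefZ coefXM mulrDl addrC; congr (_ + _).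
by case: t {IH} => [|t] /=; rewrite ?mul0r // coef_deriv mulr_natl.
Qed.

Lemma horner_iter_theta (F : comNzRingType) (N : F) c (P : {poly F}) n y : (size P <= n)%N ->
  (iter c (theta N) P).[y] = \sum_(t < n) P`_t * ((N + t%:R) ^+ c * y ^+ t).
Proof.
move=> sP; rewrite (@horner_coef_wide _ n).
  by apply: eq_bigr => t _; rewrite coef_iter_theta mulrCA mulrA.
by apply/leq_sizeP => j nj; rewrite coef_iter_theta nth_default ?mulr0 ?(leq_trans sP).
Qed.

(** One application of [theta] lowers the multiplicity of a root by at most one; the cofactor is
    kept explicit so that the rule can be iterated. *)
Lemma theta_XsubC (F : comNzRingType) (N y : F) m (Q : {poly F}) :
  theta N (('X - y%:P) ^+ m.+1 * Q) =
  ('X - y%:P) ^+ m * (m.+1%:R *: ('X * Q) + ('X - y%:P) * theta N Q).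
Proof.
rewrite /theta derivM deriv_exp derivXsubC mul1r -pred_Sn -!mul_polyC polyC_natr.
rewrite exprS -mulr_natl; ring.
Qed.

Lemma theta_root_lt (F : comNzRingType) (N y : F) c m (Q : {poly F}) : (c < m)%N ->
  (iter c (theta N) (('X - y%:P) ^+ m * Q)).[y] = 0.
Proof.
elim: c m Q => [|c IH] [//|m] Q cm; rewrite ?iterSr ?theta_XsubC ?IH //=.
by rewrite hornerM horner_exp hornerXsubC subrr expr0n mul0r.
Qed.

(** At equal order only the terms in which every derivative hits a factor ['X - y%:P] survive; they
    give the factorial, and each ['X] in [theta] gives one factor [y]. *)
Lemma theta_root_eq (F : comNzRingType) (N y : F) c (Q : {poly F}) :
  (iter c (theta N) (('X - y%:P) ^+ c * Q)).[y] = c`!%:R * (y ^+ c * Q.[y]).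
Proof.
elim: c Q => [|c IH] Q; first by rewrite /= expr0 !mul1r.
rewrite iterSr theta_XsubC IH factS natrM hornerD hornerZ !hornerM hornerXsubC.
by rewrite subrr mul0r addr0 hornerX exprS; ring.
Qed.

Lemma polyexp_shift y c A t : y <> C0 ->
  polyexp y c (A + Z.of_nat t) = Cpowz y A * ((RtoC (IZR A) + t%:R) ^+ c * y ^+ t).
Proof.
move=> y0; rewrite /polyexp Cpowz_add_nat // !CpowE natCE plus_IZR -INR_IZR_INZ.
rewrite !CmulE mulrCA.
by congr (_ * (_ ^+ _ * _)); congr pair; rewrite /= Rplus_0_r.
Qed.

(** [P] is read as a polynomial in the shift operator. The multiplicity of [y] as a root of [P] thus
    decides whether [P] annihilates the sequence [polyexp y c]. *)
Lemma sum_polyexp (P : {poly Cplx}) n y c A : (size P <= n)%N -> y <> C0 ->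
  \sum_(t < n) P`_t * polyexp y c (A + Z.of_nat t) =
  Cpowz y A * (iter c (theta (RtoC (IZR A))) P).[y].
Proof.
move=> sP y0; rewrite (horner_iter_theta _ _ _ sP) mulr_sumr.
by apply: eq_bigr => t _; rewrite polyexp_shift // mulrCA.
Qed.

Lemma Cpowz_neq0 y A : y <> C0 -> Cpowz y A != 0.
Proof.
move=> /eqP y0; case: A => [|m|m] /=; rewrite ?CpowE ?oner_neq0 ?expf_neq0 //.
exact: (invr_neq0 y0).
Qed.

(** Vanishing is assumed only on arbitrarily long windows, since it will be known on one half-line
    only. A polynomial in the shift isolates a single term: among the nonzero coefficients of one
    base, the one with the largest exponent. *)
Lemma polyexp_independent (n : nat) (Y : nat -> Cplx) (c : nat -> nat) (a : nat -> Cplx) :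
  (forall b, (b < n)%coq_nat -> Y b <> C0) ->
  (forall b b', (b < n)%coq_nat -> (b' < n)%coq_nat ->
     Y b = Y b' -> c b = c b' -> b = b') ->
  (forall N : nat, exists A : Z, forall t, (t <= N)%coq_nat ->
     sumCn n (fun b => Cmul (a b) (polyexp (Y b) (c b) (A + Z.of_nat t))) = C0) ->
  forall b, (b < n)%coq_nat -> a b = C0.
Proof.
move=> Y0 inj vanish b1 lb1; apply/eqP; apply: contraT => ab1.
pose b0 : 'I_n := Ordinal (introT ssrnat.ltP lb1).
have [|b /andP[ab Yb] bmax] :=
  @arg_maxnP _ b0 (fun b : 'I_n => (a b != 0) && (Y b == Y b0)) (fun b => c b).
  by rewrite ab1 eqxx.
have Yn0 (i : 'I_n) : Y i <> C0 by apply: Y0; apply/ssrnat.ltP.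
(* [Q] kills the terms of all other bases; the power [c b] in [P] kills those of base [Y b] with a
   smaller exponent and leaves the term [b] up to a nonzero factor. *)
pose Q := \prod_(i < n | Y i != Y b) ('X - (Y i)%:P) ^+ (c i).+1.
pose P := ('X - (Y b)%:P) ^+ c b * Q.
have [A zA] := vanish (size P).
have: \sum_(t < size P) P`_t * \sum_(i < n) a i * polyexp (Y i) (c i) (A + Z.of_nat t) = 0.
  apply: big1 => t _; rewrite -(sumCnE n (fun i => a i * polyexp (Y i) (c i) _)) zA ?mulr0 //.
  by apply/ssrnat.leP/ltnW.
under eq_bigr do rewrite mulr_sumr.
rewrite exchange_big /= (bigD1 b) //= [X in _ + X]big1 => [|i ib]; last first.
  under eq_bigr do rewrite mulrCA.
  rewrite -mulr_sumr (sum_polyexp (n := size P)) //.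
  have [Yi|Yi] := eqVneq (Y i) (Y b); last first.
    have [R ->] : exists R, P = ('X - (Y i)%:P) ^+ (c i).+1 * R.
      by eexists; rewrite /P /Q (bigD1 i) //= mulrCA.
    by rewrite theta_root_lt ?mulr0.
  have [->|ai] := eqVneq (a i) 0; first by rewrite mul0r.
  (* Same base: maximality gives [c i <= c b], and injectivity excludes equality. *)
  rewrite Yi theta_root_lt ?mulr0 // ltn_neqAle.
  have -> : (c i <= c b)%N by apply: bmax; rewrite ai Yi.
  rewrite andbT; apply: contraNneq ib => cib; apply/eqP/val_inj.
  by apply: inj => //; apply/ssrnat.ltP; apply: ltn_ord.
under eq_bigr do rewrite mulrCA.
rewrite -mulr_sumr (sum_polyexp (n := size P)) // theta_root_eq addr0 => /eqP.
rewrite !mulf_eq0 (negbTE ab) (negbTE (Cpowz_neq0 _ (Yn0 b))) natC_eq0 /=.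
rewrite -[_ == 0%N]negbK -lt0n fact_gt0 /= (negbTE (expf_neq0 _ _)); last exact/eqP.
rewrite /Q horner_prod prodf_seq_eq0 => /hasP[i _ /andP[Yi]].
by rewrite horner_exp hornerXsubC expf_eq0 subr_eq0 eq_sym (negbTE Yi) andbF.
Qed.

(** In characteristic 0 the naturals below the size of [P - Q] would be too many distinct roots. *)
Lemma poly_eq_fun (P Q : {poly Cplx}) : (forall z, P.[z] = Q.[z]) -> P = Q.
Proof.
move=> PQ; apply/eqP; rewrite -subr_eq0; apply: contraT => nz.
have := @max_poly_roots _ (P - Q) [seq i%:R | i <- iota 0 (size (P - Q))] nz.
rewrite size_map size_iota ltnn (map_inj_uniq natC_inj) iota_uniq => -> //.
by apply/allP => z _; rewrite rootE hornerD hornerN PQ subrr.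
Qed.

(** * Consequences of the factorization into linear factors *)

Section Factorization.
Variables (n : nat) (g : nat -> Cplx) (s : nat) (y : nat -> Cplx) (rr : nat -> nat).
Variables (c : Cplx) (m : nat).
Hypothesis fact : forall z : Cplx, sumCn n (fun j => Cmul (g j) (Cpow z j)) =
  Cmul (Cmul c (Cpow z m)) (prodCn s (fun j => Cpow (Csub z (y j)) (rr j))).

Lemma factorization_poly : \poly_(j < n) g j =
  c *: ('X^m * \prod_(j < s) ('X - (y j)%:P) ^+ rr j).
Proof.
apply: poly_eq_fun => z; rewrite horner_poly hornerZ hornerM hornerXn horner_prod mulrA.
have := fact z; rewrite sumCnE prodCnE CpowE => e.
rewrite (eq_bigr (fun i : 'I_n => Cmul (g i) (Cpow z i))) => [|i _]; last by rewrite CpowE.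
rewrite e; congr (_ * _); apply: eq_bigr => j _.
by rewrite CpowE horner_exp hornerXsubC.
Qed.

Lemma polyexp_recurrence j b e : (j < s)%coq_nat -> y j <> C0 -> (b < rr j)%coq_nat ->
  sumCn n (fun t => Cmul (g t) (polyexp (y j) b (e + Z.of_nat t))) = C0.
Proof.
move=> /ssrnat.ltP js yj /ssrnat.ltP bj; rewrite sumCnE.
rewrite (eq_bigr (fun t : 'I_n => (\poly_(j < n) g j)`_t * polyexp (y j) b (e + Z.of_nat t))).
  rewrite sum_polyexp ?size_poly // factorization_poly (bigD1 (Ordinal js)) //=.
  by rewrite -mul_polyC mulrA mulrCA theta_root_lt ?mulr0.
by move=> t _; rewrite coef_poly ltn_ord.
Qed.

(** The product [R] over the nonzero roots has a nonzero constant coefficient, so the power of ['X]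
    split off is exactly [lo]; comparing degrees gives the count. *)
Lemma sum_multiplicities lo hi : c <> C0 -> (forall j, (j < s)%coq_nat -> y j <> C0) ->
  (lo <= hi)%coq_nat -> (hi < n)%coq_nat -> g lo <> C0 -> g hi <> C0 ->
  (forall j, (j < lo)%coq_nat -> g j = C0) ->
  (forall j, (hi < j)%coq_nat -> g j = C0) ->
  (sumNn s rr + lo = hi)%coq_nat.
Proof.
move=> /eqP c0 y0 /ssrnat.leP lohi /ssrnat.ltP hin /eqP glo /eqP ghi zlo zhi.
have /polyP coefE := factorization_poly.
set R := \prod_(j < s) _ in coefE.
have R0 : R`_0 != 0.
  rewrite -horner_coef0 horner_prod; apply/prodf_neq0 => j _.
  rewrite horner_exp hornerXsubC sub0r expf_neq0 // oppr_eq0; apply/eqP/y0.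
  exact/ssrnat.ltP.
have sizeR : size R = (sumNn s rr).+1.
  rewrite /R; elim: (s) => [|k IH] /=; first by rewrite big_ord0 size_poly1.
  rewrite big_ord_recr /= size_monicM ?IH ?size_exp_XsubC ?addnS //.
    by apply: monic_prod => i _; rewrite monic_exp ?monicXsubC.
  by rewrite expf_neq0 // polyXsubC_eq0.
have mlo : m = lo.
  apply/eqP; rewrite eqn_leq; apply/andP; split.
    have := coefE lo; rewrite coef_poly (leq_ltn_trans lohi hin) coefZ coefXnM.
    by case: ltnP => // _ /eqP; rewrite mulr0 (negbTE glo).
  have := coefE m; rewrite coefZ coefXnM ltnn subnn coef_poly.
  case: (leqP lo m) => // ml; rewrite (zlo m); last exact/ssrnat.ltP.
  by rewrite if_same => /esym/eqP; rewrite mulf_eq0 (negbTE c0) (negbTE R0).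
have Rn0 : R != 0 by rewrite -size_poly_eq0 sizeR.
have := congr1 (fun P : {poly Cplx} => size P) factorization_poly.
rewrite size_scale // mulrC size_mulXn // -/R sizeR mlo.
suff -> : size (\poly_(j < n) g j) = hi.+1.
  by rewrite addnS => -[->]; rewrite addnC.
apply/eqP; rewrite eqn_leq; apply/andP; split.
  apply/leq_sizeP => j hj; rewrite coef_poly zhi ?if_same //; exact/ssrnat.ltP.
by rewrite ltnNge; apply/negP => /leq_sizeP /(_ hi (leqnn _)) /eqP; rewrite coef_poly hin (negbTE ghi).
Qed.
End Factorization.

(** * Kernels, linear systems and Cramer's rule *)

Lemma det_eq0_kernel (n : nat) (M : nat -> nat -> Cplx) : detC n M = C0 ->
  exists v : nat -> Cplx, (exists j, (j < n)%coq_nat /\ v j <> C0) /\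
    forall i, (i < n)%coq_nat -> sumCn n (fun j => Cmul (M i j) (v j)) = C0.
Proof.
(* [det0P] yields a row vector, hence the transpose; [w] extends it by 0 to all of [nat]. *)
rewrite detCE -det_tr => /eqP/det0P[v v0 vM].
pose w j := if insub j is Some j' then v 0 j' else 0.
have wE (j : 'I_n) : w j = v 0 j by rewrite /w valK.
exists w; split.
  have [j vj] := rV0Pn _ v0; exists j; rewrite wE; split; first exact/ssrnat.ltP.
  exact/eqP.
move=> i /ssrnat.ltP ni; have := congr1 (fun A : 'rV_n => A 0 (Ordinal ni)) vM.
rewrite sumCnE !mxE; apply: etrans; apply: eq_bigr => j _; rewrite !mxE wE; exact: mulrC.
Qed.

Lemma det_neq0_solve (n : nat) (M : nat -> nat -> Cplx) (b : nat -> Cplx) :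
  detC n M <> C0 -> exists v : nat -> Cplx,
    forall i, (i < n)%coq_nat -> sumCn n (fun j => Cmul (M i j) (v j)) = b i.
Proof.
rewrite detCE => /eqP dM; set A := \matrix_(i, j) _ in dM.
have uA : A \in unitmx by rewrite unitmxE unitfE.
pose x := invmx A *m \col_(i < n) b i.
exists (fun j => if insub j is Some j' then x j' 0 else 0) => i /ssrnat.ltP ni.
have : (A *m x) (Ordinal ni) 0 = b i by rewrite mulKVmx // mxE.
by rewrite sumCnE !mxE => <-; apply: eq_bigr => j _; rewrite mxE valK.
Qed.

(** The adjugate turns the system into [det M * v j = ga * cofactor M r j], and the cofactors along
    row [r] do not see row [r], hence agree for [A] and [B]. The form with products on both sides
    also covers singular matrices. *)
Lemma det_replace_row (n r : nat) (A B : nat -> nat -> Cplx) (v : nat -> Cplx) (al be : Cplx) :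
  (r < n)%coq_nat -> (exists j, (j < n)%coq_nat /\ v j <> C0) ->
  (forall i j, i <> r -> A i j = B i j) ->
  (forall i, (i < n)%coq_nat ->
    sumCn n (fun j => Cmul (A i j) (v j)) = if Nat.eqb i r then al else C0) ->
  (forall i, (i < n)%coq_nat ->
    sumCn n (fun j => Cmul (B i j) (v j)) = if Nat.eqb i r then be else C0) ->
  Cmul be (detC n A) = Cmul al (detC n B).
Proof.
move=> /ssrnat.ltP rn [j [/ssrnat.ltP jn /eqP vj]] AB Av Bv; rewrite !detCE.
pose x := \col_(i < n) v i; pose r' := Ordinal rn.
have adjv (M : nat -> nat -> Cplx) ga :
    (forall i, (i < n)%coq_nat ->
      sumCn n (fun j => Cmul (M i j) (v j)) = if Nat.eqb i r then ga else C0) ->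
    \det (\matrix_(i < n, j < n) M i j) * v j =
      ga * cofactor (\matrix_(i < n, j < n) M i j) r' (Ordinal jn).
  move=> Mv; set M' := \matrix_(i, j) _.
  have M'x : M' *m x = ga *: delta_mx r' 0.
    apply/matrixP => i k; rewrite !mxE ord1 eqxx andbT.
    have := Mv i (elimT ssrnat.ltP (ltn_ord i)); rewrite sumCnE => e.
    transitivity (\sum_(j < n) M i j * v j).
      by apply: eq_bigr => l _; rewrite !mxE.
    rewrite [LHS]e; have -> : Nat.eqb i r = (i == r').
      by apply/idP/eqP => [/Nat.eqb_eq ir|->]; [apply: val_inj|apply: Nat.eqb_refl].
    by case: (_ == _); rewrite ?mulr1 ?mulr0.
  have /(congr1 (mulmx (\adj M'))) := M'x.
  rewrite mulmxA mul_adj_mx mul_scalar_mx -scalemxAr => /matrixP/(_ (Ordinal jn) 0).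
  by rewrite -colE !mxE.
have eA := adjv A al Av; have eB := adjv B be Bv.
apply: (mulIf vj); rewrite !CmulE -!mulrA eA eB (mulrCA be al); congr (_ * (_ * _)).
rewrite /cofactor; congr (_ * _); congr determinant.
apply/matrixP => i k; rewrite !mxE; apply: AB => /=.
by move/eqP; rewrite eq_sym (negbTE (neq_bump _ _)).
Qed.

Lemma underdetermined_kernel (n m : nat) (M : nat -> nat -> Cplx) : (n < m)%coq_nat ->
  exists v : nat -> Cplx, (exists j, (j < m)%coq_nat /\ v j <> C0) /\
    forall i, (i < n)%coq_nat -> sumCn m (fun j => Cmul (M i j) (v j)) = C0.
Proof.
move=> /ssrnat.ltP nm; pose A := \matrix_(j < m, i < n) M i j.
have : kermx A != 0.
  by rewrite -mxrank_eq0 mxrank_ker subn_eq0 -ltnNge (leq_ltn_trans (rank_leq_col _)).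
case/matrix0Pn => i0 [j0 v0].
pose w j := if insub j is Some j' then kermx A i0 j' else 0.
have wE (j : 'I_m) : w j = kermx A i0 j by rewrite /w valK.
exists w; split; first by exists j0; rewrite wE; split; [exact/ssrnat.ltP|exact/eqP].
move=> i /ssrnat.ltP ni; have /matrixP/(_ i0 (Ordinal ni)) := mulmx_ker A.
rewrite sumCnE mxE [RHS]mxE; apply: etrans; apply: eq_bigr => j _; rewrite wE [A _ _]mxE; exact: mulrC.
Qed.
End CplxAlgebra.

(** * Finite sums and geometric bounds *)

Lemma sumRn_ext (n : nat) (f g : nat -> R) :
  (forall i, (i < n)%nat -> f i = g i) -> sumRn n f = sumRn n g.
Proof.
  induction n as [|n IH]; intros H; simpl; [reflexivity|].
  rewrite IH, H; auto with arith.
Qed.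

Lemma sumRn_zero (n : nat) (f : nat -> R) :
  (forall i, (i < n)%nat -> f i = 0) -> sumRn n f = 0.
Proof.
  induction n as [|n IH]; intros H; simpl; [reflexivity|].
  rewrite IH, H; auto with arith; ring.
Qed.

Lemma sumRn_plus (n : nat) (f g : nat -> R) :
  sumRn n (fun i => f i + g i) = sumRn n f + sumRn n g.
Proof. induction n as [|n IH]; simpl; [|rewrite IH]; ring. Qed.

Lemma sumRn_minus (n : nat) (f g : nat -> R) :
  sumRn n (fun i => f i - g i) = sumRn n f - sumRn n g.
Proof. induction n as [|n IH]; simpl; [|rewrite IH]; ring. Qed.

Lemma sumRn_scal (n : nat) (c : R) (f : nat -> R) :
  sumRn n (fun i => c * f i) = c * sumRn n f.
Proof. induction n as [|n IH]; simpl; [|rewrite IH]; ring. Qed.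

Lemma sumRn_const (n : nat) (c : R) : sumRn n (fun _ => c) = INR n * c.
Proof. induction n as [|n IH]; [simpl; ring|cbn [sumRn]; rewrite IH, S_INR; ring]. Qed.

Lemma sumRn_exchange (n m : nat) (f : nat -> nat -> R) :
  sumRn n (fun i => sumRn m (fun j => f i j)) = sumRn m (fun j => sumRn n (fun i => f i j)).
Proof.
  induction n as [|n IH]; simpl.
  - symmetry; apply sumRn_zero; reflexivity.
  - rewrite IH, <- sumRn_plus; reflexivity.
Qed.

Lemma sumRn_le (n : nat) (f g : nat -> R) :
  (forall i, (i < n)%nat -> f i <= g i) -> sumRn n f <= sumRn n g.
Proof.
  induction n as [|n IH]; intros H; simpl; [lra|].
  apply Rplus_le_compat; auto with arith.
Qed.

Lemma sumRn_nonneg (n : nat) (f : nat -> R) :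
  (forall i, (i < n)%nat -> 0 <= f i) -> 0 <= sumRn n f.
Proof.
  intros H; rewrite <- (sumRn_zero n (fun _ => 0)) by reflexivity.
  apply sumRn_le, H.
Qed.

Lemma sumRn_ge_term (n i : nat) (f : nat -> R) :
  (forall j, (j < n)%nat -> 0 <= f j) -> (i < n)%nat -> f i <= sumRn n f.
Proof.
  induction n as [|n IH]; intros H Hi; [lia|]; simpl.
  assert (0 <= f n) by auto with arith.
  destruct (Nat.eq_dec i n) as [->|Hin].
  - assert (0 <= sumRn n f) by (apply sumRn_nonneg; auto with arith); lra.
  - assert (f i <= sumRn n f) by (apply IH; [auto with arith|lia]); lra.
Qed.

Lemma sumRn_add (n m : nat) (f : nat -> R) :
  sumRn (n + m) f = sumRn n f + sumRn m (fun i => f (n + i)%nat).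
Proof.
  induction m as [|m IH]; simpl.
  - rewrite Nat.add_0_r; ring.
  - rewrite Nat.add_succ_r; simpl; rewrite IH; ring.
Qed.

Lemma sumRn_front (n : nat) (f : nat -> R) :
  sumRn (S n) f = f O + sumRn n (fun i => f (S i)).
Proof. change (S n) with (1 + n)%nat; rewrite sumRn_add; simpl; ring. Qed.

Lemma sumRn_rev (n : nat) (f : nat -> R) :
  sumRn n f = sumRn n (fun i => f (n - S i)%nat).
Proof.
  induction n as [|n IH]; [reflexivity|].
  rewrite (sumRn_front n (fun i => f (S n - S i)%nat)); simpl.
  rewrite Nat.sub_0_r, IH; ring.
Qed.

Lemma sumRn_abs (n : nat) (f : nat -> R) :
  Rabs (sumRn n f) <= sumRn n (fun i => Rabs (f i)).
Proof.
  induction n as [|n IH]; simpl; [rewrite Rabs_R0; lra|].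
  eapply Rle_trans; [apply Rabs_triang|lra].
Qed.

Lemma sumRn_delta (n a : nat) (f : nat -> R) :
  sumRn n (fun i => if (i =? a)%nat then f i else 0) = if (a <? n)%nat then f a else 0.
Proof.
  induction n as [|n IH]; simpl; [destruct (Nat.ltb_spec a 0); [lia|reflexivity]|].
  rewrite IH.
  destruct (Nat.ltb_spec a n), (Nat.ltb_spec a (S n)), (Nat.eqb_spec n a);
    subst; try lia; ring.
Qed.

Lemma sumRn_support (n m : nat) (f : nat -> R) :
  (n <= m)%nat -> (forall i, (n <= i < m)%nat -> f i = 0) -> sumRn m f = sumRn n f.
Proof.
  intros Hnm H; replace m with (n + (m - n))%nat by lia.
  rewrite sumRn_add, (sumRn_zero (m - n)); [ring|intros i Hi; apply H; lia].
Qed.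

Lemma sumRn_telescope (n : nat) (u : nat -> R) :
  sumRn n (fun j => u (S j) - u j) = u n - u O.
Proof. induction n as [|n IH]; simpl; [|rewrite IH]; ring. Qed.

Lemma sumRn_telescope_from (n a : nat) (u : nat -> R) : (a <= n)%nat ->
  sumRn n (fun j => if (a <=? j)%nat then u (S j) - u j else 0) = u n - u a.
Proof.
  intros H; replace n with (a + (n - a))%nat by lia; rewrite sumRn_add, sumRn_zero.
  - rewrite (sumRn_ext _ _ (fun j => u (a + S j)%nat - u (a + j)%nat)).
    + rewrite (sumRn_telescope _ (fun j => u (a + j)%nat)), Nat.add_0_r; ring.
    + intros i _; destruct (Nat.leb_spec a (a + i)); [|lia].
      rewrite Nat.add_succ_r; reflexivity.
  - intros i Hi; destruct (Nat.leb_spec a i); [lia|reflexivity].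
Qed.

Lemma sumRn_below (n b : nat) (f : nat -> R) : (b <= n)%nat ->
  sumRn n (fun j => if (j <? b)%nat then f j else 0) = sumRn b f.
Proof.
  intros H; rewrite (sumRn_support b n); [|exact H|].
  - apply sumRn_ext; intros i Hi; destruct (Nat.ltb_spec i b); [reflexivity|lia].
  - intros i Hi; destruct (Nat.ltb_spec i b); [lia|reflexivity].
Qed.

Lemma sumR_from (a b : nat) (f : nat -> R) : (1 <= a)%nat ->
  sumR a b f = sumRn b (fun l => if (a <=? S l)%nat then f (S l) else 0).
Proof.
  intros Ha; induction b as [|b IH]; unfold sumR in *.
  - replace (1 - a)%nat with O by lia; reflexivity.
  - cbn [sumRn]; rewrite <- IH; destruct (Nat.leb_spec a (S b)).
    + replace (S (S b) - a)%nat with (S (S b - a)) by lia; cbn [sumRn].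
      replace (a + (S b - a))%nat with (S b) by lia; reflexivity.
    + replace (S (S b) - a)%nat with O by lia.
      replace (S b - a)%nat with O by lia; simpl; ring.
Qed.

Lemma sumR_1 (b : nat) (f : nat -> R) : sumR 1 b f = sumRn b (fun l => f (S l)).
Proof. rewrite sumR_from by lia; reflexivity. Qed.

Lemma sum_f_R0_sumRn (f : nat -> R) (n : nat) : sum_f_R0 f n = sumRn (S n) f.
Proof. induction n as [|n IH]; simpl in *; [ring|rewrite IH; ring]. Qed.

Lemma infinite_sum_finite (f : nat -> R) (N : nat) :
  (forall i, (N <= i)%nat -> f i = 0) -> infinite_sum f (sumRn N f).
Proof.
  intros H eps Heps; exists N; intros n Hn.
  rewrite sum_f_R0_sumRn, (sumRn_support N (S n)); [|lia|intros; apply H; lia].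
  rewrite Rdist_eq; exact Heps.
Qed.

(** * Geometric bounds *)

Lemma geometric_bound_zero (c C r : R) : 0 < r < 1 ->
  (forall n, Rabs c <= C * r ^ n) -> c = 0.
Proof.
  intros Hr H.
  destruct (Req_dec c 0) as [->|Hc]; [reflexivity|exfalso].
  apply Rabs_pos_lt in Hc.
  assert (HC : 0 < C) by (specialize (H O); simpl in H; lra).
  destruct (pow_lt_1_zero r ltac:(rewrite Rabs_pos_eq; lra) (Rabs c / C)) as [N HN].
  { apply Rdiv_lt_0_compat; assumption. }
  specialize (HN N (Nat.le_refl _)); specialize (H N).
  rewrite Rabs_pos_eq in HN by (apply pow_le; lra).
  apply (Rmult_lt_compat_l C) in HN; [|exact HC].
  replace (C * (Rabs c / C)) with (Rabs c) in HN by (field; lra).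
  lra.
Qed.

(** Bernoulli's inequality ([poly]) for [/ r = 1 + d] gives the bound [/ d]. *)
Lemma INR_pow_bounded (r : R) : 0 < r < 1 -> exists K, forall n, INR n * r ^ n <= K.
Proof.
  intros Hr; set (d := / r - 1).
  assert (Hd : 0 < d).
  { unfold d; assert (1 < / r) by (rewrite <- Rinv_1; apply Rinv_lt_contravar; lra); lra. }
  exists (/ d); intros n.
  assert (Hb : 1 + INR n * d <= (/ r) ^ n).
  { replace (/ r) with (1 + d) by (unfold d; ring); apply poly; exact Hd. }
  rewrite pow_inv in Hb.
  assert (Hp : 0 < r ^ n) by (apply pow_lt; lra).
  apply (Rmult_le_compat_l (r ^ n)) in Hb; [|lra].
  rewrite Rinv_r in Hb by lra.
  apply (Rmult_le_reg_l d); [exact Hd|].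
  rewrite Rinv_r by lra; nra.
Qed.

(** Each factor [INR n] is absorbed by one factor [sqrt r ^ n], so the induction has to run over all
    [r] at once. *)
Lemma pow_pow_bounded (c : nat) (r : R) : 0 < r < 1 ->
  exists K, forall n, INR n ^ c * r ^ n <= K.
Proof.
  revert r; induction c as [|c IH]; intros r Hr.
  - exists 1; intros n; simpl; rewrite Rmult_1_l.
    rewrite <- (pow1 n); apply pow_incr; lra.
  - assert (Hs : 0 < sqrt r < 1).
    { split; [apply sqrt_lt_R0; lra|].
      rewrite <- sqrt_1; apply sqrt_lt_1; lra. }
    destruct (IH (sqrt r) Hs) as [K1 HK1], (INR_pow_bounded (sqrt r) Hs) as [K2 HK2].
    exists (K2 * K1); intros n.
    replace (INR n ^ S c * r ^ n) with ((INR n * sqrt r ^ n) * (INR n ^ c * sqrt r ^ n)).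
    + apply Rmult_le_compat; auto.
      * apply Rmult_le_pos; [apply pos_INR|apply pow_le; lra].
      * apply Rmult_le_pos; [apply pow_le, pos_INR|apply pow_le; lra].
    + rewrite <- (sqrt_sqrt r) at 3 by lra; rewrite Rpow_mult_distr; simpl; ring.
Qed.

Lemma pow_geometric_bound (c : nat) (r rho : R) : 0 <= r < rho ->
  exists K, 0 <= K /\ forall n, INR n ^ c * r ^ n <= K * rho ^ n.
Proof.
  (* The midpoint of [r] and [rho], relative to [rho]: at least [r / rho], below 1, and positive
     even for [r = 0]. *)
  intros Hr; set (t := (r + rho) / 2 / rho).
  assert (Ht : 0 < t < 1).
  { unfold t; split; [apply Rdiv_lt_0_compat; lra|].
    apply (Rmult_lt_reg_r rho); [lra|]; unfold Rdiv at 1.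
    rewrite Rmult_assoc, Rinv_l by lra; lra. }
  destruct (pow_pow_bounded c t Ht) as [K HK].
  assert (HK0 : 0 <= K).
  { eapply Rle_trans; [|apply (HK O)].
    apply Rmult_le_pos; apply pow_le; [apply pos_INR|lra]. }
  exists K; split; [exact HK0|]; intros n.
  apply Rle_trans with (INR n ^ c * t ^ n * rho ^ n).
  - rewrite Rmult_assoc, <- Rpow_mult_distr.
    apply Rmult_le_compat_l; [apply pow_le, pos_INR|].
    apply pow_incr; unfold t; split; [lra|].
    unfold Rdiv at 1; rewrite Rmult_assoc, Rinv_l by lra; lra.
  - apply Rmult_le_compat_r; [apply pow_le; lra|apply HK].
Qed.

(** Among all antidifferences, minus the tail sum of [d] is the one that tends to 0, and it does so
    at the rate of [d]. *)
Lemma antidifference (d : nat -> R) (K r : R) : 0 < r < 1 ->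
  (forall n, Rabs (d n) <= K * r ^ n) ->
  exists u : nat -> R, (forall n, u (S n) - u n = d (S n)) /\
    exists K', forall n, Rabs (u n) <= K' * r ^ n.
Proof.
  intros Hr Hd.
  assert (Hg : ex_series (fun j => r ^ j)) by (apply ex_series_geom; rewrite Rabs_pos_eq; lra).
  assert (Hb : forall n j, Rabs (d (S n + j)%nat) <= K * r ^ S n * r ^ j).
  { intros n j; rewrite Rmult_assoc, <- pow_add; apply Hd. }
  assert (Hdom : forall n, ex_series (fun j => K * r ^ S n * r ^ j)).
  { intros n; apply (ex_series_scal (K := R_AbsRing) (V := R_NormedModule) (K * r ^ S n)).
    exact Hg. }
  assert (Ha : forall n, ex_series (fun j => Rabs (d (S n + j)%nat))).
  { intros n; apply (ex_series_le (K := R_AbsRing) (V := R_CompleteNormedModule)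
      _ (fun j => K * r ^ S n * r ^ j)); [|apply Hdom].
    intros j; unfold norm; simpl; unfold abs; simpl; rewrite Rabs_Rabsolu; apply Hb. }
  assert (He : forall n, ex_series (fun j => d (S n + j)%nat)).
  { intros n; apply ex_series_Rabs, Ha. }
  exists (fun n => - Series (fun j => d (S n + j)%nat)); split.
  - intros n; rewrite (Series_incr_1 (fun j => d (S n + j)%nat)) by apply He.
    rewrite Nat.add_0_r, (Series_ext (fun j => d (S n + S j)%nat) (fun j => d (S (S n) + j)%nat)).
    + ring.
    + intros j; f_equal; lia.
  - exists (K * r * Series (pow r)); intros n; rewrite Rabs_Ropp.
    eapply Rle_trans; [apply Series_Rabs, Ha|].
    eapply Rle_trans; [apply (Series_le _ (fun j => K * r ^ S n * r ^ j))|].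
    + intros j; split; [apply Rabs_pos|apply Hb].
    + apply Hdom.
    + rewrite Series_scal_l, <- tech_pow_Rmult; right; ring.
Qed.

(** * Invariant sequences of the chain *)

Section Chain.
Variables (k : nat) (p q : nat -> R).
Hypothesis Hk : (1 <= k)%nat.
Hypothesis Hp : forall j, (1 <= j <= k)%nat -> 0 <= p j.
Hypothesis Hq : forall j, (1 <= j <= k)%nat -> 0 <= q j.
Hypothesis Hsum : sumRn k (fun l => p (S l) + q (S l)) = 1.

(** Truncated subtraction on [nat] is the reflection at 0, so that one formula covers [j = 0] and
    [j >= 1]. *)
Lemma trans_jumps (i j : nat) : trans k p q i j =
  sumRn k (fun l => p (S l) * (if (i + S l =? j)%nat then 1 else 0)
                  + q (S l) * (if (i - S l =? j)%nat then 1 else 0)).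
Proof.
  destruct j as [|j]; cbn [trans].
  - unfold sumR; replace (S (2 * k) - 0)%nat with (k + S k)%nat by lia.
    (* The first [k] values of [t] are the downward jumps in reverse order; the others are jumps
       [z >= 0], which have weight 0 or lead to a positive state. *)
    rewrite sumRn_add, (sumRn_zero (S k)), Rplus_0_r.
    + rewrite sumRn_rev; apply sumRn_ext; intros l Hl.
      destruct (Nat.eqb_spec (i + S l) 0); [lia|].
      unfold Pxi; cbv zeta.
      replace (0 <? Z.of_nat (0 + (k - S l)) - Z.of_nat k)%Z with false
        by (symmetry; apply Z.ltb_ge; lia).
      replace (Z.of_nat (0 + (k - S l)) - Z.of_nat k <? 0)%Z with true
        by (symmetry; apply Z.ltb_lt; lia).
      replace (- (Z.of_nat (0 + (k - S l)) - Z.of_nat k))%Z with (Z.of_nat (S l)) by lia.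
      rewrite Nat2Z.id.
      replace (Z.of_nat (S l) <=? Z.of_nat k)%Z with true by (symmetry; apply Z.leb_le; lia).
      destruct (Z.leb_spec (Z.of_nat i + (Z.of_nat (0 + (k - S l)) - Z.of_nat k)) 0);
        destruct (Nat.eqb_spec (i - S l) 0); try lia; ring.
    + intros t Ht; cbv zeta; unfold Pxi.
      destruct t as [|t].
      * rewrite Nat.add_0_r, Nat.add_0_l, Z.sub_diag; simpl.
        destruct (_ <=? 0)%Z; reflexivity.
      * replace (Z.of_nat i + (Z.of_nat (0 + (k + S t)) - Z.of_nat k) <=? 0)%Z with false
          by (symmetry; apply Z.leb_gt; lia).
        reflexivity.
  - rewrite sumRn_plus.
    (* At most one [l] contributes to each sum. The inner test stays because [j - i] and
       [i - S (S j)] may be truncated to a wrong index. *)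
    rewrite (sumRn_ext k (fun l => p (S l) * _)
      (fun l => if (l =? j - i)%nat then p (S l) * (if (i + S l =? S j)%nat then 1 else 0) else 0)).
    2:{ intros l _; destruct (Nat.eqb_spec (i + S l) (S j)), (Nat.eqb_spec l (j - i));
          try lia; ring. }
    rewrite (sumRn_ext k (fun l => q (S l) * _)
      (fun l => if (l =? i - S (S j))%nat then q (S l) * (if (i - S l =? S j)%nat then 1 else 0) else 0)).
    2:{ intros l _; destruct (Nat.eqb_spec (i - S l) (S j)), (Nat.eqb_spec l (i - S (S j)));
          try lia; ring. }
    rewrite (sumRn_delta k (j - i) (fun l => p (S l) * (if (i + S l =? S j)%nat then 1 else 0))).
    rewrite (sumRn_delta k (i - S (S j))
      (fun l => q (S l) * (if (i - S l =? S j)%nat then 1 else 0))).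
    unfold Pxi.
    destruct (Z.ltb_spec 0 (Z.of_nat (S j) - Z.of_nat i)).
    + destruct (Nat.eqb_spec (i - S (i - S (S j))) (S j)); [lia|].
      destruct (Nat.eqb_spec (i + S (j - i)) (S j)); [|lia].
      replace (Z.to_nat (Z.of_nat (S j) - Z.of_nat i)) with (S (j - i)) by lia.
      destruct (Z.leb_spec (Z.of_nat (S j) - Z.of_nat i) (Z.of_nat k)),
        (Nat.ltb_spec (j - i) k), (Nat.ltb_spec (i - S (S j)) k); try lia; ring.
    + destruct (Nat.eqb_spec (i + S (j - i)) (S j)); [lia|].
      destruct (Z.ltb_spec (Z.of_nat (S j) - Z.of_nat i) 0).
      * destruct (Nat.eqb_spec (i - S (i - S (S j))) (S j)); [|lia].
        replace (Z.to_nat (- (Z.of_nat (S j) - Z.of_nat i))) with (S (i - S (S j))) by lia.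
        destruct (Z.leb_spec (- (Z.of_nat (S j) - Z.of_nat i)) (Z.of_nat k)),
          (Nat.ltb_spec (j - i) k), (Nat.ltb_spec (i - S (S j)) k); try lia; ring.
      * destruct (Nat.eqb_spec (i - S (i - S (S j))) (S j)); [lia|].
        destruct (Nat.ltb_spec (j - i) k), (Nat.ltb_spec (i - S (S j)) k); ring.
Qed.

Lemma trans_apply (f : nat -> R) (M i : nat) :
  sumRn M (fun j => trans k p q i j * f j) =
  sumRn k (fun l => p (S l) * (if (i + S l <? M)%nat then f (i + S l)%nat else 0)
                  + q (S l) * (if (i - S l <? M)%nat then f (i - S l)%nat else 0)).
Proof.
  rewrite (sumRn_ext M _ (fun j => sumRn k (fun l =>
    p (S l) * (if (j =? i + S l)%nat then f j else 0)
    + q (S l) * (if (j =? i - S l)%nat then f j else 0)))).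
  - rewrite sumRn_exchange; apply sumRn_ext; intros l _.
    rewrite sumRn_plus, !sumRn_scal, !sumRn_delta; reflexivity.
  - intros j _; rewrite trans_jumps, Rmult_comm, <- sumRn_scal.
    apply sumRn_ext; intros l _.
    rewrite (Nat.eqb_sym j (i + S l)), (Nat.eqb_sym j (i - S l)).
    destruct (Nat.eqb_spec (i + S l) j), (Nat.eqb_spec (i - S l) j); ring.
Qed.

Lemma jump_nonneg (l : nat) (a b : R) : (l < k)%nat -> 0 <= a -> 0 <= b ->
  0 <= p (S l) * a + q (S l) * b.
Proof.
  intros Hl Ha Hb; apply Rplus_le_le_0_compat; apply Rmult_le_pos; auto;
    [apply Hp|apply Hq]; lia.
Qed.

Lemma trans_nonneg (i j : nat) : 0 <= trans k p q i j.
Proof.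
  rewrite trans_jumps; apply sumRn_nonneg; intros l Hl; apply jump_nonneg; [exact Hl| |].
  - destruct (_ =? _)%nat; lra.
  - destruct (_ =? _)%nat; lra.
Qed.

Lemma trans_far (i j : nat) : (j + k < i)%nat -> trans k p q i j = 0.
Proof.
  intros H; rewrite trans_jumps; apply sumRn_zero; intros l Hl.
  destruct (Nat.eqb_spec (i + S l) j), (Nat.eqb_spec (i - S l) j); try lia; ring.
Qed.

Lemma trans_row_le (M i : nat) : sumRn M (fun j => trans k p q i j) <= 1.
Proof.
  rewrite (sumRn_ext M _ (fun j => trans k p q i j * 1)) by (intros; ring).
  rewrite (trans_apply (fun _ => 1)); eapply Rle_trans; [|right; apply Hsum].
  apply sumRn_le; intros l Hl.
  assert (0 <= p (S l)) by (apply Hp; lia).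
  assert (0 <= q (S l)) by (apply Hq; lia).
  destruct (_ <? _)%nat, (_ <? _)%nat; lra.
Qed.

(** States above [j + k] do not reach [j] in one step, so a finite sum suffices and signed sequences
    raise no question of convergence. *)
Definition invariant (x : nat -> R) : Prop :=
  forall j, sumRn (S (j + k)) (fun i => x i * trans k p q i j) = x j.

Lemma invariant_sum (x : nat -> R) (j N : nat) : invariant x -> (j + k < N)%nat ->
  sumRn N (fun i => x i * trans k p q i j) = x j.
Proof.
  intros Hx HN; rewrite <- Hx; apply sumRn_support; [lia|].
  intros i Hi; rewrite trans_far by lia; ring.
Qed.

Lemma invariant_infinite_sum (x : nat -> R) :
  invariant x <-> forall j, infinite_sum (fun i => x i * trans k p q i j) (x j).
Proof.
  assert (H : forall j, infinite_sum (fun i => x i * trans k p q i j)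
    (sumRn (S (j + k)) (fun i => x i * trans k p q i j))).
  { intros j; apply infinite_sum_finite; intros i Hi.
    rewrite trans_far by lia; ring. }
  split; intros Hx j.
  - rewrite <- (Hx j); apply H.
  - eapply uniqueness_sum; [apply H|apply Hx].
Qed.

Lemma invariant_linear (x y : nat -> R) (c : R) : invariant x -> invariant y ->
  invariant (fun i => x i + c * y i).
Proof.
  intros Hx Hy j; rewrite <- (Hx j), <- (Hy j), <- sumRn_scal, <- sumRn_plus.
  apply sumRn_ext; intros; ring.
Qed.

(* [|x|] is subinvariant, and no mass can be gained because the rows of the
   transition matrix sum to at most one. *)
Lemma invariant_abs (x : nat -> R) :
  Un_cv x 0 -> invariant x -> invariant (fun i => Rabs (x i)).
Proof.
  intros Hb Hx.
  set (a := fun i => Rabs (x i)).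
  set (F := fun j => sumRn (S (j + k)) (fun i => a i * trans k p q i j)).
  assert (Ha : forall i, 0 <= a i) by (intros; apply Rabs_pos).
  assert (Hsub : forall j, 0 <= F j - a j).
  { intros j; unfold F, a; rewrite <- (Hx j).
    apply Rle_minus_r; rewrite Rplus_0_l; eapply Rle_trans; [apply sumRn_abs|].
    apply sumRn_le; intros i _; rewrite Rabs_mult, (Rabs_pos_eq (trans _ _ _ _ _)).
    - lra.
    - apply trans_nonneg. }
  (* Mass gained below [M] can only come from the [k] states starting at [M], as no state sends out
     more than it holds. *)
  assert (Htail : forall M, sumRn M (fun j => F j - a j) <= sumRn k (fun i => a (M + i)%nat)).
  { intros M.
    rewrite (sumRn_ext M _ (fun j => sumRn (M + k) (fun i => a i * trans k p q i j) + (-1) * a j)).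
    - rewrite sumRn_plus, sumRn_scal, sumRn_exchange.
      assert (sumRn (M + k) (fun i => sumRn M (fun j => a i * trans k p q i j)) <= sumRn (M + k) a).
      { apply sumRn_le; intros i _; rewrite sumRn_scal.
        rewrite <- (Rmult_1_r (a i)) at 2.
        apply Rmult_le_compat_l; [apply Ha|apply trans_row_le]. }
      rewrite (sumRn_add M k a) in H; lra.
    - intros j Hj; unfold F.
      rewrite (sumRn_support (S (j + k)) (M + k)); [ring|lia|].
      intros i Hi; rewrite trans_far by lia; ring. }
  intros j; change (F j = a j); apply Rminus_diag_uniq.
  apply Rle_antisym; [|apply Hsub]; apply le_epsilon; intros eps Heps.
  destruct (Hb (eps / INR k)) as [N HN].
  { apply Rdiv_lt_0_compat; [exact Heps|apply lt_0_INR; lia]. }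
  eapply Rle_trans; [apply (sumRn_ge_term (S j + N) j (fun j => F j - a j))|].
  - intros; apply Hsub.
  - lia.
  - eapply Rle_trans; [apply Htail|].
    apply Rle_trans with (sumRn k (fun _ => eps / INR k)).
    + apply sumRn_le; intros i _; unfold a.
      assert (H := HN (S j + N + i)%nat ltac:(lia)).
      unfold Rdist in H; rewrite Rminus_0_r in H; lra.
    + right; rewrite sumRn_const; field; apply not_0_INR; lia.
Qed.

(** * The coefficients of [psi] and the drift *)

Lemma drift_sum : drift k p q = sumRn k (fun l => INR (S l) * (p (S l) - q (S l))).
Proof. apply sumR_1. Qed.

Lemma gamma_low (j : nat) : (j < k)%nat ->
  gamma k p q j = - sumRn k (fun l => if (k - S l <=? j)%nat then p (S l) else 0).
Proof.
  intros Hj; unfold gamma; destruct (Nat.leb_spec j (k - 1)); [|lia].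
  rewrite sumR_from by lia; f_equal; apply sumRn_ext; intros l Hl.
  destruct (Nat.leb_spec (k - j) (S l)), (Nat.leb_spec (k - S l) j); try lia; reflexivity.
Qed.

Lemma gamma_high (j : nat) :
  gamma k p q (k + j) = sumRn k (fun l => if (j <? S l)%nat then q (S l) else 0).
Proof.
  unfold gamma; destruct (Nat.leb_spec (k + j) (k - 1)); [lia|].
  rewrite sumR_from by lia; apply sumRn_ext; intros l Hl.
  destruct (Nat.leb_spec (k + j - k + 1) (S l)), (Nat.ltb_spec j (S l)); try lia; reflexivity.
Qed.

(** The [gamma] are tail sums of [p] and [q], so summation by parts returns the jump probabilities.
    This is the identity between [(z - 1) psi(z)] and the sum of all [p_l z^(k-l) + q_l z^(k+l)]
    minus [z^k], with powers replaced by a sequence; the right-hand side is the defect of invariance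
    at position [k]. *)
Lemma gamma_by_parts (u : nat -> R) :
  sumRn (2 * k) (fun j => gamma k p q j * (u (S j) - u j)) =
  sumRn k (fun l => p (S l) * u (k - S l)%nat + q (S l) * u (k + S l)%nat) - u k.
Proof.
  replace (2 * k)%nat with (k + k)%nat by lia; rewrite sumRn_add.
  rewrite (sumRn_ext k _ (fun j => sumRn k (fun l =>
    - p (S l) * (if (k - S l <=? j)%nat then u (S j) - u j else 0)))).
  2:{ intros j Hj; rewrite gamma_low by exact Hj.
      rewrite <- (Rmult_1_l (sumRn _ _)), Ropp_mult_distr_l, <- sumRn_scal.
      rewrite Rmult_comm, <- sumRn_scal; apply sumRn_ext; intros l _.
      destruct (_ <=? _)%nat; ring. }
  rewrite (sumRn_ext k (fun i => gamma k p q (k + i) * _) (fun j => sumRn k (fun l =>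
    q (S l) * (if (j <? S l)%nat then u (k + S j)%nat - u (k + j)%nat else 0)))).
  2:{ intros j Hj; rewrite gamma_high, Rmult_comm, <- sumRn_scal.
      apply sumRn_ext; intros l _; rewrite Nat.add_succ_r.
      destruct (_ <? _)%nat; ring. }
  rewrite (sumRn_exchange k k (fun j l =>
    - p (S l) * (if (k - S l <=? j)%nat then u (S j) - u j else 0))).
  rewrite (sumRn_exchange k k (fun j l =>
    q (S l) * (if (j <? S l)%nat then u (k + S j)%nat - u (k + j)%nat else 0))).
  rewrite <- sumRn_plus.
  rewrite (sumRn_ext k _ (fun l => (p (S l) * u (k - S l)%nat + q (S l) * u (k + S l)%nat)
    + (- u k) * (p (S l) + q (S l)))).
  - rewrite sumRn_plus, sumRn_scal, Hsum; ring.
  - intros l Hl; rewrite !sumRn_scal, sumRn_telescope_from by lia.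
    rewrite (sumRn_below k (S l) (fun j => u (k + S j)%nat - u (k + j)%nat)) by lia.
    rewrite (sumRn_telescope (S l) (fun j => u (k + j)%nat)), Nat.add_0_r; ring.
Qed.

(** Linear [u] in [gamma_by_parts]. The value is [psi 1], so 1 is not a root when the drift is
    nonzero. *)
Lemma gamma_sum : sumRn (2 * k) (gamma k p q) = - drift k p q.
Proof.
  rewrite (sumRn_ext _ _ (fun j => gamma k p q j * (INR (S j) - INR j)))
    by (intros; rewrite S_INR; ring).
  rewrite (gamma_by_parts INR), drift_sum.
  rewrite (sumRn_ext k _ (fun l => INR k * (p (S l) + q (S l))
    + (-1) * (INR (S l) * (p (S l) - q (S l))))).
  - rewrite sumRn_plus, !sumRn_scal, Hsum; ring.
  - intros l Hl; rewrite minus_INR, plus_INR by lia; ring.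
Qed.

(* The generating function of the jumps is [1 + z^-k (z - 1) psi(z)], and
   [psi 1 = - drift > 0]. *)
Lemma contracting_weight : drift k p q < 0 -> exists z, 0 < z < 1 /\
  sumRn k (fun l => p (S l) * z ^ (k - S l) + q (S l) * z ^ (k + S l)) < z ^ k.
Proof.
  intros Hmu.
  set (f := fun z => sumRn (2 * k) (fun j => gamma k p q j * z ^ j)).
  assert (Hf1 : f 1 = - drift k p q).
  { rewrite <- gamma_sum; apply sumRn_ext; intros; rewrite pow1; ring. }
  assert (Hc : continuity_pt f 1).
  { unfold f; clear; induction (2 * k)%nat as [|n IH]; cbn [sumRn].
    - apply continuity_pt_const; intros ? ?; reflexivity.
    - apply (continuity_pt_plus (fun z => sumRn n (fun j => gamma k p q j * z ^ j))
        (fun z => gamma k p q n * z ^ n)); [exact IH|].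
      apply (continuity_pt_scal (fun z => z ^ n)).
      apply derivable_continuous_pt, derivable_pt_pow. }
  destruct (Hc (f 1)) as [al [Hal Hz]]; [rewrite Hf1; lra|].
  (* [al] comes from continuity at 1, where [f] is positive; the bound [1 / 2] keeps [z]
     positive. *)
  set (z := Rmax (1 / 2) (1 - al / 2)).
  assert (Hz1 : 0 < z < 1).
  { unfold z; split; [eapply Rlt_le_trans; [|apply Rmax_l]; lra|apply Rmax_lub_lt; lra]. }
  exists z; split; [exact Hz1|].
  assert (Hfz : 0 < f z).
  { specialize (Hz z); simpl in Hz; unfold Rdist, D_x, no_cond in Hz.
    assert (H : Rabs (f z - f 1) < f 1).
    { apply Hz; split; [split; [exact I|lra]|].
      rewrite Rabs_left by lra.
      assert (1 - al / 2 <= z) by apply Rmax_r; lra. }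
    apply Rabs_def2 in H; lra. }
  assert (E := gamma_by_parts (fun j => z ^ j)); cbv beta in E.
  rewrite (sumRn_ext _ _ (fun j => (z - 1) * (gamma k p q j * z ^ j))) in E
    by (intros; simpl; ring).
  rewrite sumRn_scal in E; fold (f z) in E; nra.
Qed.

(** * Vanishing of invariant and of harmonic sequences *)

Variable kq : nat.
Hypothesis Hkq1 : (1 <= kq <= k)%nat.
Hypothesis Hkq2 : 0 < q kq.
Hypothesis Hkq3 : forall j, (kq < j <= k)%nat -> q j = 0.

(** Each state [S i] jumps to the lower state [S i - kq], reflected if need be, with probability at
    least [q kq]; mass at [S i] would show up where there is known to be none. *)
Lemma invariant_zero (x : nat -> R) :
  (forall i, 0 <= x i) -> invariant x -> x O = 0 -> forall i, x i = 0.
Proof.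
  intros Hpos Hx H0 i; induction i as [i IH] using lt_wf_ind.
  destruct i as [|i]; [exact H0|].
  assert (Hlow : x (S i - kq)%nat = 0) by (apply IH; lia).
  rewrite <- (invariant_sum x _ (S (S i) + k) Hx) in Hlow by lia.
  assert (Hterm : x (S i) * trans k p q (S i) (S i - kq) <= 0).
  { rewrite <- Hlow.
    apply (sumRn_ge_term _ (S i) (fun i0 => x i0 * trans k p q i0 (S i - kq))); [|lia].
    intros; apply Rmult_le_pos; [apply Hpos|apply trans_nonneg]. }
  assert (Htr : q kq <= trans k p q (S i) (S i - kq)).
  { rewrite trans_jumps.
    eapply Rle_trans; [|apply (sumRn_ge_term k (kq - 1))]; [| |lia].
    - cbv beta; replace (S (kq - 1)) with kq by lia; rewrite Nat.eqb_refl.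
      assert (0 <= p kq) by (apply Hp; lia).
      destruct (_ =? _)%nat; lra.
    - intros l Hl; apply jump_nonneg; [exact Hl| |]; destruct (_ =? _)%nat; lra. }
  specialize (Hpos (S i)); nra.
Qed.

Lemma invariant_zero_signed (x : nat -> R) :
  Un_cv x 0 -> invariant x -> x O = 0 -> forall i, x i = 0.
Proof.
  intros Hb Hx H0 i; apply Rabs_eq_0.
  apply (invariant_zero (fun i => Rabs (x i))).
  - intros; apply Rabs_pos.
  - apply invariant_abs; assumption.
  - rewrite H0; apply Rabs_R0.
Qed.

(* Testing invariance against the function [N - i] (truncated at [0]). *)
Lemma invariant_zero_of_drift (x : nat -> R) :
  0 < sumRn k (fun l => p (S l)) -> 0 <= drift k p q ->
  (forall i, 0 <= x i) -> Un_cv x 0 -> invariant x -> forall i, x i = 0.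
Proof.
  intros Hpsum Hmu Hpos Hcv Hx; apply (invariant_zero x Hpos Hx).
  (* [B N i] is the mean one-step change of the truncated function [N - i] when the chain leaves
     [i]. *)
  set (B := fun N i => sumRn k (fun l =>
    p (S l) * (INR (N - (i + S l)) - INR (N - i)) + q (S l) * (INR (N - (i - S l)) - INR (N - i)))).
  assert (Hbal : forall N, sumRn (N + k) (fun i => x i * B N i) = 0).
  { intros N.
    assert (H1 : sumRn N (fun j => x j * INR (N - j)) = sumRn (N + k) (fun i =>
      x i * sumRn k (fun l => p (S l) * INR (N - (i + S l)) + q (S l) * INR (N - (i - S l))))).
    { rewrite (sumRn_ext N _ (fun j => sumRn (N + k) (fun i =>
        x i * (trans k p q i j * INR (N - j))))).
      - rewrite sumRn_exchange; apply sumRn_ext; intros i _.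
        rewrite sumRn_scal, (trans_apply (fun j => INR (N - j))); f_equal.
        apply sumRn_ext; intros l _; f_equal; f_equal.
        + destruct (Nat.ltb_spec (i + S l) N); [reflexivity|].
          replace (N - (i + S l))%nat with O by lia; reflexivity.
        + destruct (Nat.ltb_spec (i - S l) N); [reflexivity|].
          replace (N - (i - S l))%nat with O by lia; reflexivity.
      - intros j Hj; rewrite <- (invariant_sum x j (N + k) Hx) at 1 by lia.
        rewrite Rmult_comm, <- sumRn_scal; apply sumRn_ext; intros; ring. }
    assert (H2 : sumRn (N + k) (fun i => x i * INR (N - i)) = sumRn N (fun j => x j * INR (N - j))).
    { apply sumRn_support; [lia|]; intros i Hi.
      replace (N - i)%nat with O by lia; simpl; ring. }
    rewrite (sumRn_ext _ _ (fun i => x i * sumRn k (fun l =>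
      p (S l) * INR (N - (i + S l)) + q (S l) * INR (N - (i - S l))) + (-1) * (x i * INR (N - i)))).
    - rewrite sumRn_plus, sumRn_scal, H2, H1; ring.
    - intros i _; unfold B.
      rewrite (sumRn_ext k _ (fun l => (p (S l) * INR (N - (i + S l)) + q (S l) * INR (N - (i - S l)))
        + (- INR (N - i)) * (p (S l) + q (S l)))) by (intros; ring).
      rewrite sumRn_plus, sumRn_scal, Hsum; ring. }
  set (b := sumRn k (fun l => q (S l) * INR (S l))).
  assert (Hb : 0 <= b).
  { apply sumRn_nonneg; intros l Hl; apply Rmult_le_pos; [apply Hq; lia|apply pos_INR]. }
  assert (HB : forall N i, B N i <= b).
  { intros N i; apply sumRn_le; intros l Hl.
    assert (0 <= p (S l)) by (apply Hp; lia).
    assert (0 <= q (S l)) by (apply Hq; lia).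
    assert (INR (N - (i + S l)) <= INR (N - i)) by (apply le_INR; lia).
    assert (INR (N - (i - S l)) <= INR (N - i) + INR (S l)).
    { rewrite <- plus_INR; apply le_INR; lia. }
    nra. }
  (* Here no upward jump is truncated at [N], and reflection at 0 can only reduce the gain of a
     downward jump. *)
  assert (HB0 : forall N i, (i + k <= N)%nat -> B N i <= 0).
  { intros N i Hi; apply Rle_trans with (- drift k p q); [|lra].
    rewrite drift_sum, <- (Rmult_1_l (sumRn _ _)), Ropp_mult_distr_l, <- sumRn_scal.
    apply sumRn_le; intros l Hl.
    assert (0 <= q (S l)) by (apply Hq; lia).
    rewrite (minus_INR N (i + S l)), (minus_INR N i), plus_INR by lia.
    assert (INR (N - (i - S l)) <= INR N - INR i + INR (S l)).
    { rewrite <- minus_INR, <- plus_INR by lia; apply le_INR; lia. }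
    nra. }
  set (a := sumRn k (fun l => p (S l))).
  (* From 0 only upward jumps change the state, each by at least 1. *)
  assert (HB00 : forall N, (k <= N)%nat -> B N O <= - a).
  { intros N HN; unfold a.
    rewrite <- (Rmult_1_l (sumRn _ _)), Ropp_mult_distr_l, <- sumRn_scal.
    apply sumRn_le; intros l Hl.
    assert (0 <= p (S l)) by (apply Hp; lia).
    rewrite (minus_INR N (0 + S l)) by lia.
    rewrite !Nat.sub_0_l, Nat.sub_0_r, Nat.add_0_l, S_INR.
    pose proof (pos_INR l); nra. }
  destruct (Req_dec (x O) 0) as [H0|H0]; [exact H0|exfalso].
  assert (Hx0 : 0 < x O) by (specialize (Hpos O); lra).
  assert (Ha : 0 < a * x O) by (apply Rmult_lt_0_compat; assumption).
  (* Only the last [k + k] states of the balance can contribute positively, each less than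
     [a * x O / c] times [b]; as [c] exceeds [b * INR (k + k)], their total stays below
     [a * x O]. *)
  set (c := b * INR (k + k) + 1).
  assert (Hc : 0 < c) by (pose proof (pos_INR (k + k)); unfold c; nra).
  destruct (Hcv (a * x O / c)) as [n Hn]; [apply Rdiv_lt_0_compat; assumption|].
  specialize (Hbal (S n + k)%nat).
  replace (S n + k + k)%nat with (S n + (k + k))%nat in Hbal by lia.
  rewrite sumRn_add, sumRn_front in Hbal.
  assert (E1 : x O * B (S n + k)%nat O <= - (a * x O)).
  { assert (B (S n + k)%nat O <= - a) by (apply HB00; lia); nra. }
  assert (E2 : sumRn n (fun i => x (S i) * B (S n + k)%nat (S i)) <= 0).
  { rewrite <- (sumRn_zero n (fun _ => 0)) by reflexivity.
    apply sumRn_le; intros i Hi.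
    assert (B (S n + k)%nat (S i) <= 0) by (apply HB0; lia).
    specialize (Hpos (S i)); nra. }
  assert (E3 : sumRn (k + k) (fun i => x (S n + i)%nat * B (S n + k)%nat (S n + i)%nat)
    <= INR (k + k) * (a * x O / c * b)).
  { rewrite <- sumRn_const; apply sumRn_le; intros i _.
    assert (Hs := Hn (S n + i)%nat ltac:(lia)).
    unfold Rdist in Hs; rewrite Rminus_0_r in Hs; apply Rabs_def2 in Hs.
    specialize (HB (S n + k)%nat (S n + i)%nat); specialize (Hpos (S n + i)%nat).
    nra. }
  assert (E4 : INR (k + k) * (a * x O / c * b) = a * x O * ((c - 1) / c)).
  { unfold c; field; fold c; lra. }
  assert (E5 : (c - 1) / c < 1).
  { apply (Rmult_lt_reg_r c); [exact Hc|]; unfold Rdiv.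
    rewrite Rmult_assoc, Rinv_l by lra; lra. }
  nra.
Qed.

(* Maximum principle for the weighted function [|h n| z^n], which tends to [0]
   and so attains its supremum. *)
Lemma harmonic_zero (h : nat -> R) (z : R) : 0 < z < 1 ->
  sumRn k (fun l => p (S l) * z ^ (k - S l) + q (S l) * z ^ (k + S l)) < z ^ k ->
  (forall i, (kq <= i)%nat ->
     sumRn k (fun l => p (S l) * h (i + S l)%nat + q (S l) * h (i - S l)%nat) = h i) ->
  (forall i, (i < kq)%nat -> h i = 0) ->
  Un_cv (fun n => h n * z ^ n) 0 -> forall n, h n = 0.
Proof.
  intros Hz Hlt Hharm Hlow Hcv.
  set (w := fun n => Rabs (h n) * z ^ n).
  assert (Hzp : forall n, 0 < z ^ n) by (intros; apply pow_lt; lra).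
  assert (Hw : forall n, 0 <= w n).
  { intros n; apply Rmult_le_pos; [apply Rabs_pos|left; apply Hzp]. }
  intros n0; destruct (Req_dec (h n0) 0) as [E|Hn0]; [exact E|exfalso].
  assert (Hwn0 : 0 < w n0) by (apply Rmult_lt_0_compat; [apply Rabs_pos_lt; exact Hn0|apply Hzp]).
  destruct (Hcv (w n0) Hwn0) as [N HN].
  assert (HwN : forall n, (N <= n)%nat -> w n < w n0).
  { intros n Hn; specialize (HN n Hn); unfold Rdist in HN.
    rewrite Rminus_0_r, Rabs_mult, (Rabs_pos_eq (z ^ n)) in HN by (left; apply Hzp).
    exact HN. }
  assert (Hmax : forall M, exists m, forall n, (n < M)%nat -> w n <= w m).
  { induction M as [|M [m Hm]]; [exists O; intros; lia|].
    destruct (Rle_dec (w M) (w m)) as [Hle|Hle].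
    - exists m; intros n Hn; destruct (Nat.eq_dec n M) as [->|]; [assumption|apply Hm; lia].
    - exists M; intros n Hn; destruct (Nat.eq_dec n M) as [->|]; [lra|].
      apply Rle_trans with (w m); [apply Hm; lia|lra]. }
  (* From [N] on the weight is below [w n0], so a maximum over a range containing [n0] and
     everything below [N] is global. *)
  destruct (Hmax (N + S n0)%nat) as [m Hm].
  assert (Hm0 : w n0 <= w m) by (apply Hm; lia).
  assert (Hsup : forall n, w n <= w m).
  { intros n; destruct (Nat.lt_ge_cases n (N + S n0)) as [Hn|Hn]; [apply Hm, Hn|].
    specialize (HwN n ltac:(lia)); lra. }
  assert (Hkm : (kq <= m)%nat).
  { destruct (Nat.lt_ge_cases m kq) as [Hlt'|]; [|assumption].
    unfold w at 2 in Hm0; rewrite (Hlow m Hlt'), Rabs_R0 in Hm0; lra. }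
  assert (Hle : w m * z ^ k <=
    w m * sumRn k (fun l => p (S l) * z ^ (k - S l) + q (S l) * z ^ (k + S l))).
  { unfold w at 1; rewrite <- (Hharm m Hkm), Rmult_assoc, <- pow_add, Rmult_comm.
    eapply Rle_trans.
    { apply Rmult_le_compat_l; [left; apply Hzp|apply sumRn_abs]. }
    rewrite <- !sumRn_scal; apply sumRn_le; intros l Hl.
    assert (Hpl : 0 <= p (S l)) by (apply Hp; lia).
    assert (Hql : 0 <= q (S l)) by (apply Hq; lia).
    eapply Rle_trans.
    { apply Rmult_le_compat_l; [left; apply Hzp|apply Rabs_triang]. }
    rewrite !Rabs_mult, (Rabs_pos_eq (p _)), (Rabs_pos_eq (q _)) by assumption.
    rewrite !Rmult_plus_distr_l; apply Rplus_le_compat.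
    - replace (z ^ (m + k) * (p (S l) * Rabs (h (m + S l)%nat)))
        with (w (m + S l)%nat * (p (S l) * z ^ (k - S l))).
      + apply Rmult_le_compat_r; [|apply Hsup].
        apply Rmult_le_pos; [assumption|left; apply Hzp].
      + unfold w; replace (m + k)%nat with ((m + S l) + (k - S l))%nat by lia.
        rewrite (pow_add z (m + S l) (k - S l)); ring.
    (* For [S l <= kq <= m] the subtraction is genuine; longer downward jumps have probability 0. *)
    - destruct (Nat.le_gt_cases (S l) kq) as [Hlq|Hlq].
      + replace (z ^ (m + k) * (q (S l) * Rabs (h (m - S l)%nat)))
          with (w (m - S l)%nat * (q (S l) * z ^ (k + S l))).
        * apply Rmult_le_compat_r; [|apply Hsup].
          apply Rmult_le_pos; [assumption|left; apply Hzp].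
        * unfold w; replace (m + k)%nat with ((m - S l) + (k + S l))%nat by lia.
          rewrite (pow_add z (m - S l) (k + S l)); ring.
      + rewrite Hkq3 by lia; lra. }
  apply Rmult_le_reg_l in Hle; lra.
Qed.

(** * Flow across edges and decaying solutions of the recurrence *)

Lemma gamma_leading (j : nat) : (k + kq - 1 < j)%nat -> gamma k p q j = 0.
Proof.
  intros Hj; replace j with (k + (j - k))%nat by lia; rewrite gamma_high.
  apply sumRn_zero; intros l Hl.
  destruct (Nat.ltb_spec (j - k) (S l)); [apply Hkq3; lia|reflexivity].
Qed.

Variable kp : nat.
Hypothesis Hkp1 : (1 <= kp <= k)%nat.
Hypothesis Hkp3 : forall j, (kp < j <= k)%nat -> p j = 0.

Lemma gamma_trailing (j : nat) : (j < k - kp)%nat -> gamma k p q j = 0.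
Proof.
  intros Hj; rewrite gamma_low by lia.
  rewrite sumRn_zero; [ring|]; intros l Hl.
  destruct (Nat.leb_spec (k - S l) j); [apply Hkp3; lia|reflexivity].
Qed.

Lemma weighted_differences (n : nat) (x : nat -> R) :
  sumRn n (fun t => (INR n - INR t) * (x (S t) - x t)) =
  sumRn n (fun t => x (S t)) - INR n * x O.
Proof.
  induction n as [|n IH]; [simpl; ring|].
  rewrite (sumRn_ext (S n) _ (fun t => (INR n - INR t) * (x (S t) - x t) + (x (S t) - x t)))
    by (intros; rewrite S_INR; ring).
  rewrite sumRn_plus, sumRn_telescope; cbn [sumRn]; rewrite IH, S_INR; ring.
Qed.

(** Index [m] stands for position [m - k]; the shift keeps every negative position that the
    recurrence reaches within [nat]. *)
Definition padded (x : nat -> R) (m : nat) : R := if (m <? k)%nat then 0 else x (m - k)%nat.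

Lemma padded_add (x : nat -> R) (m : nat) : padded x (k + m) = x m.
Proof.
  unfold padded; destruct (Nat.ltb_spec (k + m) k); [lia|f_equal; lia].
Qed.

(* The left-hand side is the net flow of mass from [{1, 2, ...}] to [{0}]. *)
Lemma flow_at_zero (x : nat -> R) :
  sumRn (2 * k) (fun j => gamma k p q j * padded x (S j)) =
  sumRn k (fun l => q (S l) * sumRn (S l) (fun t => x (S t)))
  - sumRn k (fun l => p (S l)) * x O.
Proof.
  replace (2 * k)%nat with (k + k)%nat by lia; rewrite sumRn_add.
  rewrite (sumRn_ext k (fun j => gamma k p q j * _)
    (fun j => if (j =? k - 1)%nat then gamma k p q j * x O else 0)).
  2:{ intros j Hj; destruct (Nat.eqb_spec j (k - 1)).
      - replace (S j) with (k + 0)%nat by lia; rewrite padded_add; reflexivity.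
      - unfold padded; destruct (Nat.ltb_spec (S j) k); [ring|lia]. }
  rewrite (sumRn_delta k (k - 1) (fun j => gamma k p q j * x O)).
  destruct (Nat.ltb_spec (k - 1) k); [|lia].
  rewrite (sumRn_ext k (fun i => gamma k p q (k + i) * _) (fun j => sumRn k (fun l =>
    q (S l) * (if (j <? S l)%nat then x (S j) else 0)))).
  2:{ intros j Hj; rewrite gamma_high, <- Nat.add_succ_r, padded_add, Rmult_comm, <- sumRn_scal.
      apply sumRn_ext; intros l _; destruct (_ <? _)%nat; ring. }
  rewrite sumRn_exchange, gamma_low by lia.
  rewrite (sumRn_ext k (fun j => sumRn k (fun i => q (S j) * _))
    (fun l => q (S l) * sumRn (S l) (fun t => x (S t)))).
  2:{ intros l Hl; rewrite sumRn_scal, (sumRn_below k (S l) (fun j => x (S j))) by lia.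
      reflexivity. }
  rewrite (sumRn_ext k (fun l => if (k - S l <=? k - 1)%nat then _ else _) (fun l => p (S l))).
  - ring.
  - intros l Hl; destruct (Nat.leb_spec (k - S l) (k - 1)); [reflexivity|lia].
Qed.

(** As [eta] at [kp + t] is the sum of [(l - t) q_l] over [l > t], Abel summation turns differences
    into values. Together with [flow_at_zero] this identifies the last row of [Omega] with zero flow
    between 0 and the positive states. *)
Lemma eta_sum (x : nat -> R) :
  sumRn kq (fun t => eta kp kq q (kp + t) * (x (S t) - x t)) =
  sumRn k (fun l => q (S l) * sumRn (S l) (fun t => x (S t)))
  - x O * sumR 1 kq (fun l => INR l * q l).
Proof.
  rewrite (sumRn_ext kq _ (fun t => sumRn kq (fun l => q (S l) *
    (if (t <? S l)%nat then (INR (S l) - INR t) * (x (S t) - x t) else 0)))).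
  - rewrite sumRn_exchange, sumR_1, <- sumRn_scal.
    rewrite (sumRn_support kq k); [|lia|intros; rewrite Hkq3 by lia; ring].
    rewrite <- sumRn_minus; apply sumRn_ext; intros l Hl.
    rewrite sumRn_scal, (sumRn_below kq (S l)
      (fun t => (INR (S l) - INR t) * (x (S t) - x t))) by lia.
    rewrite weighted_differences; ring.
  - intros t Ht; unfold eta.
    destruct (Nat.leb_spec kp (kp + t)); [|lia].
    destruct (Nat.leb_spec (kp + t) (kp + kq - 1)); [|lia]; cbn [andb].
    rewrite sumR_from, Rmult_comm, <- sumRn_scal by lia; apply sumRn_ext; intros l Hl.
    rewrite plus_INR.
    destruct (Nat.leb_spec (kp + t - kp + 1) (S l)), (Nat.ltb_spec t (S l)); try lia; ring.
Qed.

(** Left of [2 - kp] the solution [d] in general differs from the differences of the sequence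
    extended by 0; [Hinit] makes the two agree wherever the equations of the states [n >= 1]
    look. *)
Section DecayingSolution.
Variables (d : Z -> R) (x0 K r : R).
Hypothesis Hmu : drift k p q < 0.
Hypothesis Hrec : forall e : Z,
  sumRn (2 * k) (fun j => gamma k p q j * d (e + Z.of_nat j)%Z) = 0.
Hypothesis Hinit : forall e : Z, (2 - Z.of_nat kp <= e <= 0)%Z ->
  d e = if (e =? 0)%Z then x0 else 0.
Hypothesis Hlast : sumRn kq (fun t => eta kp kq q (kp + t) * d (Z.of_nat (S t))) =
  x0 * (sumR 1 kp p - sumR 1 kq (fun l => INR l * q l)).
Hypothesis Hr : 0 < r < 1.
Hypothesis Hdecay : forall n, Rabs (d (Z.of_nat n)) <= K * r ^ n.

Let x (n : nat) : R := x0 + sumRn n (fun t => d (Z.of_nat (S t))).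

Lemma solution_step (n : nat) : x (S n) - x n = d (Z.of_nat (S n)).
Proof. unfold x; cbn [sumRn]; ring. Qed.

Lemma padded_recurrence (n : nat) : (1 <= n)%nat ->
  sumRn (2 * k) (fun j => gamma k p q j * (padded x (n + S j) - padded x (n + j))) = 0.
Proof.
  intros Hn; rewrite <- (Hrec (Z.of_nat n + 1 - Z.of_nat k)).
  apply sumRn_ext; intros j Hj.
  (* Coefficients below [k - kp] vanish, and [1 <= n] then keeps the argument of [d] at [2 - kp] or
     above. *)
  destruct (Nat.lt_ge_cases j (k - kp)) as [Hlow|Hlow].
  - rewrite gamma_trailing by exact Hlow; ring.
  - f_equal; destruct (Nat.lt_ge_cases (n + j) k) as [Hnj|Hnj].
    + rewrite Hinit by lia; unfold padded at 2; destruct (Nat.ltb_spec (n + j) k); [|lia].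
      destruct (Z.eqb_spec (Z.of_nat n + 1 - Z.of_nat k + Z.of_nat j) 0).
      * replace (n + S j)%nat with (k + 0)%nat by lia; rewrite padded_add.
        unfold x; simpl; ring.
      * unfold padded; destruct (Nat.ltb_spec (n + S j) k); [ring|lia].
    + replace (n + S j)%nat with (k + S (n + j - k))%nat by lia.
      replace (n + j)%nat with (k + (n + j - k))%nat at 2 by lia.
      rewrite !padded_add, solution_step; f_equal; lia.
Qed.

(** The left-hand side is the net flow across the edge between [n] and [n + 1]: it is 0 at [n = 0]
    by [Hlast], and the recurrence says that it does not change with [n]. *)
Lemma padded_flow (n : nat) :
  sumRn (2 * k) (fun j => gamma k p q j * padded x (S n + j)) = 0.
Proof.
  induction n as [|n IH].
  - change (sumRn (2 * k) (fun j => gamma k p q j * padded x (S j)) = 0).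
    rewrite flow_at_zero.
    assert (E := eta_sum x).
    rewrite (sumRn_ext kq _ (fun t => eta kp kq q (kp + t) * d (Z.of_nat (S t)))) in E
      by (intros; rewrite solution_step; reflexivity).
    rewrite Hlast, sumR_1 in E.
    replace (x O) with x0 in E |- * by (unfold x; simpl; ring).
    rewrite (sumRn_support kp k (fun l => p (S l))); [|lia|intros; apply Hkp3; lia].
    lra.
  - assert (E := padded_recurrence (S n) ltac:(lia)).
    rewrite (sumRn_ext _ _ (fun j => gamma k p q j * padded x (S (S n) + j)
      + (-1) * (gamma k p q j * padded x (S n + j)))) in E.
    + rewrite sumRn_plus, sumRn_scal, IH in E; lra.
    + intros j _; rewrite Nat.add_succ_r; simpl; ring.
Qed.

Lemma solution_invariant : invariant x.
Proof.
  intros j; rewrite (sumRn_ext _ _ (fun i => sumRn k (fun l =>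
    p (S l) * (if (i + S l =? j)%nat then x i else 0)
    + q (S l) * (if (i - S l =? j)%nat then x i else 0)))).
  2:{ intros i _; rewrite trans_jumps, <- sumRn_scal; apply sumRn_ext; intros l _.
      destruct (_ =? _)%nat, (_ =? _)%nat; ring. }
  rewrite sumRn_exchange; destruct j as [|j].
  (* State 0 keeps the mass of its downward jumps, a fraction 1 minus the sum of [p], so invariance
     there is the zero-flow equation. *)
  - assert (E := padded_flow 0).
    change (sumRn (2 * k) (fun j => gamma k p q j * padded x (S j)) = 0) in E.
    rewrite flow_at_zero in E.
    rewrite (sumRn_ext k _ (fun l => q (S l) * sumRn (S l) (fun t => x (S t)) + x O * q (S l))).
    + rewrite sumRn_plus, sumRn_scal; rewrite sumRn_plus in Hsum.
      replace (sumRn k (fun l => q (S l))) with (1 - sumRn k (fun l => p (S l))) by lra.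
      lra.
    + intros l Hl; rewrite sumRn_plus, !sumRn_scal.
      rewrite (sumRn_zero _ (fun i => if (i + S l =? 0)%nat then _ else _)).
      2:{ intros i _; destruct (Nat.eqb_spec (i + S l) 0); [lia|reflexivity]. }
      rewrite (sumRn_ext _ _ (fun i => if (i <? S (S l))%nat then x i else 0)).
      2:{ intros i _; destruct (Nat.eqb_spec (i - S l) 0), (Nat.ltb_spec i (S (S l)));
            try lia; reflexivity. }
      rewrite sumRn_below, sumRn_front by lia; ring.
  - assert (E := gamma_by_parts (fun t => padded x (S j + t))); cbv beta in E.
    rewrite padded_recurrence in E by lia.
    rewrite (Nat.add_comm (S j) k), padded_add in E.
    replace (x (S j)) with
      (sumRn k (fun l => p (S l) * padded x (S j + (k - S l)) + q (S l) * padded x (S j + (k + S l))))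
      by lra.
    apply sumRn_ext; intros l Hl; rewrite sumRn_plus, !sumRn_scal; f_equal; f_equal.
    + rewrite (sumRn_ext _ _ (fun i => if (i =? S j - S l)%nat then
        (if (S l <=? S j)%nat then x i else 0) else 0)).
      2:{ intros i _; destruct (Nat.eqb_spec (i + S l) (S j)), (Nat.eqb_spec i (S j - S l)),
            (Nat.leb_spec (S l) (S j)); try lia; reflexivity. }
      rewrite (sumRn_delta _ (S j - S l) (fun i => if (S l <=? S j)%nat then x i else 0)).
      destruct (Nat.ltb_spec (S j - S l) (S (S j + k))); [|lia].
      destruct (Nat.leb_spec (S l) (S j)).
      * replace (S j + (k - S l))%nat with (k + (S j - S l))%nat by lia.
        rewrite padded_add; reflexivity.
      * unfold padded; destruct (Nat.ltb_spec (S j + (k - S l)) k); [reflexivity|lia].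
    + rewrite (sumRn_ext _ _ (fun i => if (i =? S j + S l)%nat then x i else 0)).
      2:{ intros i _; destruct (Nat.eqb_spec (i - S l) (S j)), (Nat.eqb_spec i (S j + S l));
            try lia; reflexivity. }
      rewrite sumRn_delta.
      destruct (Nat.ltb_spec (S j + S l) (S (S j + k))); [|lia].
      replace (S j + (k + S l))%nat with (k + (S j + S l))%nat by lia.
      rewrite padded_add; reflexivity.
Qed.

(* The constant zero flow is asymptotically [drift * lim x], so [lim x = 0]. *)
Lemma solution_decay : exists K', forall n, Rabs (x n) <= K' * r ^ n.
Proof.
  destruct (antidifference (fun n => d (Z.of_nat n)) K r Hr Hdecay) as [u [Hu [K' HK']]].
  assert (Hxu : forall n, x n = u n + (x0 - u O)).
  { induction n as [|n IH]; [unfold x; simpl; ring|].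
    assert (E1 := solution_step n); specialize (Hu n); lra. }
  assert (Hlim : drift k p q * (x0 - u O) = 0).
  { apply (geometric_bound_zero _ (sumRn (2 * k) (fun j => Rabs (gamma k p q j) * (K' * r ^ S j))) r Hr).
    intros m; assert (E := padded_flow (k + m)).
    rewrite (sumRn_ext _ _ (fun j => gamma k p q j * u (m + S j)%nat
      + (x0 - u O) * gamma k p q j)) in E.
    - rewrite sumRn_plus, sumRn_scal, gamma_sum in E.
      replace (drift k p q * (x0 - u O)) with
        (sumRn (2 * k) (fun j => gamma k p q j * u (m + S j)%nat)) by lra.
      eapply Rle_trans; [apply sumRn_abs|].
      rewrite Rmult_comm, <- sumRn_scal; apply sumRn_le; intros j _.
      rewrite Rabs_mult.
      replace (r ^ m * (Rabs (gamma k p q j) * (K' * r ^ S j)))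
        with (Rabs (gamma k p q j) * (K' * r ^ (m + S j))) by (rewrite pow_add; ring).
      apply Rmult_le_compat_l; [apply Rabs_pos|apply HK'].
    - intros j _; replace (S (k + m) + j)%nat with (k + (m + S j))%nat by lia.
      rewrite padded_add, Hxu; ring. }
  apply Rmult_integral in Hlim; destruct Hlim as [Hlim|Hlim]; [lra|].
  exists K'; intros n; rewrite Hxu, Hlim, Rplus_0_r; apply HK'.
Qed.
End DecayingSolution.
End Chain.

(** * The columns of [Psi] and the matrices [Omega] *)

Lemma Cplx_ring : ring_theory C0 C1 Cadd Cmul Csub Copp eq.
Proof.
  constructor; intros.
  - apply Cadd_0_l.
  - apply Cadd_comm.
  - apply Cadd_assoc.
  - apply Cmul_1_l.
  - apply Cmul_comm.
  - apply Cmul_assoc.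
  - apply Cmul_add_l.
  - reflexivity.
  - rewrite Cadd_comm; apply Cadd_opp_l.
Qed.
Add Ring Cplx_ring_instance : Cplx_ring.

Lemma sumCn_ext (n : nat) (f g : nat -> Cplx) :
  (forall i, (i < n)%nat -> f i = g i) -> sumCn n f = sumCn n g.
Proof.
  induction n as [|n IH]; intros H; simpl; [reflexivity|].
  rewrite IH, H; auto with arith.
Qed.

Lemma sumCn_zero (n : nat) (f : nat -> Cplx) :
  (forall i, (i < n)%nat -> f i = C0) -> sumCn n f = C0.
Proof.
  induction n as [|n IH]; intros H; simpl; [reflexivity|].
  rewrite IH, H; auto with arith; ring.
Qed.

Lemma sumCn_plus (n : nat) (f g : nat -> Cplx) :
  sumCn n (fun i => Cadd (f i) (g i)) = Cadd (sumCn n f) (sumCn n g).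
Proof. induction n as [|n IH]; simpl; [|rewrite IH]; ring. Qed.

Lemma sumCn_scal (n : nat) (c : Cplx) (f : nat -> Cplx) :
  sumCn n (fun i => Cmul c (f i)) = Cmul c (sumCn n f).
Proof. induction n as [|n IH]; simpl; [|rewrite IH]; ring. Qed.

Lemma sumCn_exchange (n m : nat) (f : nat -> nat -> Cplx) :
  sumCn n (fun i => sumCn m (fun j => f i j)) = sumCn m (fun j => sumCn n (fun i => f i j)).
Proof.
  induction n as [|n IH]; simpl.
  - symmetry; apply sumCn_zero; reflexivity.
  - rewrite IH, <- sumCn_plus; reflexivity.
Qed.

(** The operations on [Cplx] are convertible with those of Coquelicot, so its facts on the modulus
    apply as they stand. *)
Lemma Cmod_Cmul (u v : Cplx) : Cmod (Cmul u v) = Cmod u * Cmod v.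
Proof. exact (Complex.Cmod_mult u v). Qed.

Lemma Cmod_Cadd (u v : Cplx) : Cmod (Cadd u v) <= Cmod u + Cmod v.
Proof. exact (Complex.Cmod_triangle u v). Qed.

Lemma Cmod_pos (u : Cplx) : 0 <= Cmod u.
Proof. exact (Complex.Cmod_ge_0 u). Qed.

Lemma Cmod_RtoC (a : R) : Cmod (RtoC a) = Rabs a.
Proof. exact (Complex.Cmod_R a). Qed.

Lemma Cmod_C0 : Cmod C0 = 0.
Proof. exact Complex.Cmod_0. Qed.

Lemma Cmod_gt_0 (u : Cplx) : u <> C0 -> 0 < Cmod u.
Proof. exact (proj1 (Complex.Cmod_gt_0 u)). Qed.

Lemma Cmod_Cpow (u : Cplx) (n : nat) : Cmod (Cpow u n) = Cmod u ^ n.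
Proof.
  induction n as [|n IH]; simpl.
  - change C1 with (RtoC 1); rewrite Cmod_RtoC; apply Rabs_R1.
  - rewrite Cmod_Cmul, IH; reflexivity.
Qed.

Lemma Cmod_Cinv (u : Cplx) : u <> C0 -> Cmod (Cinv u) = / Cmod u.
Proof.
  intros Hu; assert (H := f_equal Cmod (Cinv_l u Hu)).
  apply Cmod_gt_0 in Hu; rewrite Cmod_Cmul in H.
  change C1 with (RtoC 1) in H; rewrite Cmod_RtoC, Rabs_R1 in H.
  apply (Rmult_eq_reg_r (Cmod u)); [|lra]; rewrite H; field; lra.
Qed.

Lemma Cmul_RtoC (a b : R) : Cmul (RtoC a) (RtoC b) = RtoC (a * b).
Proof. unfold Cmul, RtoC; simpl; f_equal; ring. Qed.

Lemma Cmul_neq_0 (u v : Cplx) : u <> C0 -> v <> C0 -> Cmul u v <> C0.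
Proof.
  intros Hu Hv H; apply Hv.
  rewrite <- (Cmul_1_l v), <- (Cinv_l u Hu), <- Cmul_assoc, H; ring.
Qed.

Lemma Cpow_C1 (n : nat) : Cpow C1 n = C1.
Proof. induction n as [|n IH]; simpl; [reflexivity|rewrite IH; ring]. Qed.

Lemma polyexp_C1 (e : Z) : polyexp C1 0 e = C1.
Proof.
  assert (H : Cinv C1 = C1) by (unfold Cinv, C1; simpl; f_equal; field).
  unfold polyexp; destruct e; simpl; rewrite ?H, ?Cpow_C1; ring.
Qed.

Lemma Cmod_polyexp_nat (y : Cplx) (c n : nat) :
  Cmod (polyexp y c (Z.of_nat n)) = INR n ^ c * Cmod y ^ n.
Proof.
  unfold polyexp; rewrite Cmod_Cmul, Cmod_Cpow, Cmod_RtoC, <- INR_IZR_INZ.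
  rewrite Rabs_pos_eq by apply pos_INR; f_equal.
  rewrite <- Cmod_Cpow; f_equal; destruct n as [|n]; [reflexivity|].
  simpl; rewrite SuccNat2Pos.id_succ; reflexivity.
Qed.

Lemma Cmod_polyexp_opp (y : Cplx) (c n : nat) : y <> C0 ->
  Cmod (polyexp y c (- Z.of_nat n)) = INR n ^ c * (/ Cmod y) ^ n.
Proof.
  intros Hy; unfold polyexp.
  rewrite Cmod_Cmul, Cmod_Cpow, Cmod_RtoC, opp_IZR, Rabs_Ropp, <- INR_IZR_INZ.
  rewrite Rabs_pos_eq by apply pos_INR; f_equal.
  rewrite <- Cmod_Cinv, <- Cmod_Cpow by exact Hy; f_equal; destruct n as [|n]; [reflexivity|].
  simpl; rewrite SuccNat2Pos.id_succ; reflexivity.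
Qed.

Lemma geometric_cv (x : nat -> R) (K r : R) : 0 < r < 1 ->
  (forall n, Rabs (x n) <= K * r ^ n) -> Un_cv x 0.
Proof.
  intros Hr H eps Heps.
  assert (HK : 0 <= K) by (specialize (H O); pose proof (Rabs_pos (x O)); simpl in H; lra).
  destruct (pow_lt_1_zero r ltac:(rewrite Rabs_pos_eq; lra) (eps / (K + 1))) as [N HN].
  { apply Rdiv_lt_0_compat; lra. }
  exists N; intros n Hn; unfold Rdist; rewrite Rminus_0_r.
  specialize (HN n Hn); specialize (H n).
  assert (Hp : 0 < r ^ n) by (apply pow_lt; lra).
  rewrite Rabs_pos_eq in HN by lra.
  apply (Rmult_lt_compat_l (K + 1)) in HN; [|lra].
  replace ((K + 1) * (eps / (K + 1))) with eps in HN by (field; lra).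
  nra.
Qed.

Lemma combination_geometric_bound (N : nat) (f : nat -> nat -> Cplx) (v : nat -> Cplx) (r : R) :
  0 < r ->
  (forall b, (b < N)%nat -> exists K, 0 <= K /\ forall n, Cmod (f b n) <= K * r ^ n) ->
  exists K, forall n, Cmod (sumCn N (fun b => Cmul (v b) (f b n))) <= K * r ^ n.
Proof.
  intros Hr; induction N as [|N IH]; intros H.
  - exists 0; intros n; simpl; rewrite Cmod_C0; lra.
  - destruct IH as [K1 HK1]; [intros b Hb; apply H; lia|].
    destruct (H N ltac:(lia)) as [K2 [_ HK2]].
    exists (K1 + Cmod (v N) * K2); intros n; simpl.
    eapply Rle_trans; [apply Cmod_Cadd|].
    rewrite Rmult_plus_distr_r; apply Rplus_le_compat; [apply HK1|].
    rewrite Cmod_Cmul, Rmult_assoc; apply Rmult_le_compat_l; [apply Cmod_pos|apply HK2].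
Qed.

(** Abstracts the real and the imaginary part, so that each transfer from real to complex sequences
    is proved once for both. *)
Record real_functional (pr : Cplx -> R) : Prop := {
  rf_add : forall u v, pr (Cadd u v) = pr u + pr v;
  rf_scal : forall a z, pr (Cmul (RtoC a) z) = a * pr z;
  rf_bound : forall z, Rabs (pr z) <= Cmod z }.

Lemma rf_fst : real_functional fst.
Proof.
  constructor.
  - reflexivity.
  - intros; simpl; ring.
  - intros z; eapply Rle_trans; [apply Rmax_l|apply (Complex.Rmax_Cmod z)].
Qed.

Lemma rf_snd : real_functional snd.
Proof.
  constructor.
  - reflexivity.
  - intros; simpl; ring.
  - intros z; eapply Rle_trans; [apply Rmax_r|apply (Complex.Rmax_Cmod z)].
Qed.

Lemma rf_C0 (pr : Cplx -> R) : real_functional pr -> pr C0 = 0.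
Proof.
  intros H; replace C0 with (Cmul (RtoC 0) C0) by ring.
  rewrite (rf_scal _ H); ring.
Qed.

Lemma rf_sum (pr : Cplx -> R) (n : nat) (f : nat -> Cplx) : real_functional pr ->
  pr (sumCn n f) = sumRn n (fun i => pr (f i)).
Proof.
  intros H; induction n as [|n IH]; simpl; [apply rf_C0, H|].
  rewrite (rf_add _ H), IH; reflexivity.
Qed.

Lemma Cplx_eq_0 (z : Cplx) : (forall pr, real_functional pr -> pr z = 0) -> z = C0.
Proof.
  intros H; destruct z as [a b]; unfold C0.
  f_equal; [apply (H fst rf_fst)|apply (H snd rf_snd)].
Qed.

(* [(j, c')] such that the [c]-th column of the concatenation of the blocks
   [j, j + 1, ...] is the [c']-th column of block [j]. *)
Fixpoint locate (rr : nat -> nat) (fuel j c : nat) : nat * nat :=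
  match fuel with
  | O => (j, c)
  | S f => if (c <? rr j)%nat then (j, c) else locate rr f (S j) (c - rr j)
  end.

Lemma sumNn_front (n : nat) (f : nat -> nat) :
  sumNn (S n) f = (f O + sumNn n (fun i => f (S i)))%nat.
Proof. induction n as [|n IH]; [simpl; lia|]; cbn [sumNn] in *; rewrite IH; lia. Qed.

Lemma sumNn_ext (n : nat) (f g : nat -> nat) :
  (forall i, f i = g i) -> sumNn n f = sumNn n g.
Proof. intros H; induction n as [|n IH]; simpl; [|rewrite IH, H]; reflexivity. Qed.

Lemma locate_ge (rr : nat -> nat) (fuel j c : nat) : (j <= fst (locate rr fuel j c))%nat.
Proof.
  revert j c; induction fuel as [|f IH]; intros j c; simpl; [lia|].
  destruct (_ <? _)%nat; simpl; [lia|specialize (IH (S j) (c - rr j)%nat); lia].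
Qed.

Lemma locate_spec (rr : nat -> nat) (fuel j c : nat) :
  (c < sumNn fuel (fun i => rr (j + i)))%nat ->
  (fst (locate rr fuel j c) < j + fuel)%nat /\
  (snd (locate rr fuel j c) < rr (fst (locate rr fuel j c)))%nat /\
  forall kp y i, concat_col kp y rr fuel j c i =
    Yentry kp (y (fst (locate rr fuel j c))) i (snd (locate rr fuel j c)).
Proof.
  revert j c; induction fuel as [|f IH]; intros j c Hc; [simpl in Hc; lia|].
  rewrite sumNn_front, Nat.add_0_r in Hc; simpl.
  destruct (Nat.ltb_spec c (rr j)) as [H|H]; simpl.
  - split; [lia|]; split; [exact H|reflexivity].
  - destruct (IH (S j) (c - rr j)%nat) as [H1 [H2 H3]].
    + rewrite (sumNn_ext f _ (fun i => rr (j + S i)%nat)); [lia|].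
      intros i; f_equal; lia.
    + split; [lia|]; split; [exact H2|exact H3].
Qed.

(** Transfers the ascending order of the roots to the columns. *)
Lemma locate_mono (rr : nat -> nat) (fuel j c c' : nat) : (c <= c')%nat ->
  (fst (locate rr fuel j c) <= fst (locate rr fuel j c'))%nat.
Proof.
  revert j c c'; induction fuel as [|f IH]; intros j c c' H; simpl; [lia|].
  destruct (Nat.ltb_spec c (rr j)), (Nat.ltb_spec c' (rr j)); simpl; try lia.
  - pose proof (locate_ge rr f (S j) (c' - rr j)); lia.
  - apply IH; lia.
Qed.

Lemma locate_inj (rr : nat -> nat) (fuel j c c' : nat) :
  locate rr fuel j c = locate rr fuel j c' -> c = c'.
Proof.
  revert j c c'; induction fuel as [|f IH]; intros j c c' H; simpl in H.
  - congruence.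
  - destruct (Nat.ltb_spec c (rr j)), (Nat.ltb_spec c' (rr j)).
    + congruence.
    + pose proof (locate_ge rr f (S j) (c' - rr j)); rewrite <- H in *; simpl in *; lia.
    + pose proof (locate_ge rr f (S j) (c - rr j)); rewrite H in *; simpl in *; lia.
    + apply IH in H; lia.
Qed.

Definition combination (n : nat) (v Y : nat -> Cplx) (c : nat -> nat) (e : Z) : Cplx :=
  sumCn n (fun b => Cmul (v b) (polyexp (Y b) (c b) e)).

Lemma gamma_combination (n N : nat) (g : nat -> Cplx) (v Y : nat -> Cplx) (c : nat -> nat) (e : Z) :
  sumCn N (fun t => Cmul (g t) (combination n v Y c (e + Z.of_nat t))) =
  sumCn n (fun b => Cmul (v b)
    (sumCn N (fun t => Cmul (g t) (polyexp (Y b) (c b) (e + Z.of_nat t))))).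
Proof.
  unfold combination.
  rewrite (sumCn_ext N _ (fun t => sumCn n (fun b =>
    Cmul (v b) (Cmul (g t) (polyexp (Y b) (c b) (e + Z.of_nat t)))))).
  - rewrite sumCn_exchange; apply sumCn_ext; intros b _; apply sumCn_scal.
  - intros t _; rewrite <- sumCn_scal; apply sumCn_ext; intros b _; ring.
Qed.

Section Leap.
Variables (k : nat) (p q : nat -> R) (kp kq : nat).
Hypothesis Hk : (1 <= k)%nat.
Hypothesis Hp : forall j, (1 <= j <= k)%nat -> 0 <= p j.
Hypothesis Hq : forall j, (1 <= j <= k)%nat -> 0 <= q j.
Hypothesis Hsum : sumRn k (fun l => p (S l) + q (S l)) = 1.
Hypothesis Hkp1 : (1 <= kp <= k)%nat.
Hypothesis Hkp2 : 0 < p kp.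
Hypothesis Hkp3 : forall j, (kp < j <= k)%nat -> p j = 0.
Hypothesis Hkq1 : (1 <= kq <= k)%nat.
Hypothesis Hkq2 : 0 < q kq.
Hypothesis Hkq3 : forall j, (kq < j <= k)%nat -> q j = 0.
Hypothesis Hmu : drift k p q < 0.

Let ga (t : nat) : Cplx := RtoC (gamma k p q t).

Lemma rf_gamma (pr : Cplx -> R) (f : nat -> Cplx) : real_functional pr ->
  pr (sumCn (2 * k) (fun t => Cmul (ga t) (f t))) =
  sumRn (2 * k) (fun t => gamma k p q t * pr (f t)).
Proof.
  intros H; rewrite rf_sum by exact H; apply sumRn_ext; intros; apply (rf_scal _ H).
Qed.

Lemma gamma_trailing_neq0 : gamma k p q (k - kp) <> 0.
Proof.
  rewrite gamma_low by lia.
  assert (p kp <= sumRn k (fun l => if (k - S l <=? k - kp)%nat then p (S l) else 0)); [|lra].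
  eapply Rle_trans; [|apply (sumRn_ge_term k (kp - 1))].
  - cbv beta; replace (S (kp - 1)) with kp by lia; rewrite Nat.leb_refl; lra.
  - intros l Hl; destruct (_ <=? _)%nat; [apply Hp; lia|lra].
  - lia.
Qed.

Lemma gamma_leading_neq0 : gamma k p q (k + kq - 1) <> 0.
Proof.
  replace (k + kq - 1)%nat with (k + (kq - 1))%nat by lia; rewrite gamma_high by lia.
  assert (q kq <= sumRn k (fun l => if (kq - 1 <? S l)%nat then q (S l) else 0)); [|lra].
  eapply Rle_trans; [|apply (sumRn_ge_term k (kq - 1))].
  - cbv beta; replace (S (kq - 1)) with kq by lia.
    destruct (Nat.ltb_spec (kq - 1) kq); [lra|lia].
  - intros l Hl; destruct (_ <? _)%nat; [apply Hq; lia|lra].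
  - lia.
Qed.

(** * Roots of [psi] inside the unit disc *)

Section Spectrum.
(** The nonzero roots repeated by multiplicity, flattened into columns: column [b] has base [Y b]
    and exponent [c b]. *)
Variables (Y : nat -> Cplx) (c : nat -> nat).
Hypothesis HY0 : forall b, (b < kp + kq - 1)%nat -> Y b <> C0.
Hypothesis HY1 : forall b, (b < kp + kq - 1)%nat -> Y b <> C1.
Hypothesis HYinj : forall b b', (b < kp + kq - 1)%nat -> (b' < kp + kq - 1)%nat ->
  Y b = Y b' -> c b = c b' -> b = b'.
Hypothesis HYmono : forall b b', (b <= b')%nat -> (b' < kp + kq - 1)%nat ->
  Cmod (Y b) <= Cmod (Y b').
Hypothesis HYrec : forall b e, (b < kp + kq - 1)%nat ->
  sumCn (2 * k) (fun t => Cmul (ga t) (polyexp (Y b) (c b) (e + Z.of_nat t))) = C0.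

(* If column [kp - 1] had modulus at least one, the columns [kp - 1, ...] and
   the constant [1] would give [kq + 1] independent functions [n |-> h (- n)],
   harmonic for the walk and of subexponential growth; some nonzero combination
   vanishes on [kq] consecutive points, against the maximum principle. *)
Lemma small_roots (b : nat) : (b < kp)%nat -> Cmod (Y b) < 1.
Proof.
  intros Hb; destruct (Rlt_dec (Cmod (Y b)) 1) as [|Hge]; [assumption|exfalso].
  set (Y' := fun j => match j with O => C1 | S j' => Y (kp - 1 + j')%nat end).
  set (c' := fun j => match j with O => O | S j' => c (kp - 1 + j')%nat end).
  assert (HY'0 : forall j, (j < S kq)%nat -> Y' j <> C0).
  { intros [|j] Hj; simpl; [apply C1_neq_C0|apply HY0; lia]. }
  assert (HY'mod : forall j, (j < S kq)%nat -> 1 <= Cmod (Y' j)).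
  { intros [|j] Hj; simpl.
    - change C1 with (RtoC 1); rewrite Cmod_RtoC, Rabs_R1; lra.
    - assert (Cmod (Y b) <= Cmod (Y (kp - 1 + j)%nat)) by (apply HYmono; lia); lra. }
  destruct (CplxAlgebra.underdetermined_kernel
    (fun i j => polyexp (Y' j) (c' j) (- Z.of_nat i)) (Nat.lt_succ_diag_r kq)) as [v [Hv Hker]].
  set (D := combination (S kq) v Y' c').
  assert (HDlow : forall i, (i < kq)%nat -> D (- Z.of_nat i)%Z = C0).
  { intros i Hi; rewrite <- (Hker i Hi); apply sumCn_ext; intros; apply Cmul_comm. }
  (* The recurrence annihilates the root columns and maps the constant 1 to a constant, so its value
     on [D] does not depend on [e]; the difference of consecutive values is the harmonicity of
     [D]. *)
  assert (Hshift : forall e, sumCn (2 * k) (fun t => Cmul (ga t) (D (e + Z.of_nat t)%Z)) =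
    sumCn (2 * k) (fun t => Cmul (ga t) (D (e + 1 + Z.of_nat t)%Z))).
  { intros e; unfold D; rewrite !gamma_combination; apply sumCn_ext.
    intros [|j] Hj; f_equal; simpl.
    - apply sumCn_ext; intros; rewrite !polyexp_C1; reflexivity.
    - rewrite !HYrec by lia; reflexivity. }
  destruct (contracting_weight k p q Hk Hsum Hmu) as [z [Hz Hcontr]].
  (* The inverse moduli are at most 1, so only polynomial growth is left, and [z ^ n] absorbs it at
     any rate above [z]; the rate is the midpoint of [z] and 1. *)
  assert (HDgrow : exists K r, 0 < r < 1 /\
    forall n, Cmod (D (- Z.of_nat n)%Z) * z ^ n <= K * r ^ n).
  { destruct (combination_geometric_bound (S kq)
      (fun j n => Cmul (RtoC (z ^ n)) (polyexp (Y' j) (c' j) (- Z.of_nat n))) v ((1 + z) / 2))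
      as [K HK]; [lra| |].
    - intros j Hj; destruct (pow_geometric_bound (c' j) z ((1 + z) / 2)) as [K [HK0 HK]]; [lra|].
      exists K; split; [exact HK0|]; intros n.
      eapply Rle_trans; [|apply HK].
      rewrite Cmod_Cmul, Cmod_RtoC, Cmod_polyexp_opp by (apply HY'0; exact Hj).
      assert (0 < z ^ n) by (apply pow_lt; lra).
      rewrite Rabs_pos_eq by lra.
      assert ((/ Cmod (Y' j)) ^ n <= 1).
      { specialize (HY'mod j Hj); rewrite <- (pow1 n); apply pow_incr; split.
        - left; apply Rinv_0_lt_compat; lra.
        - rewrite <- Rinv_1; apply Rinv_le_contravar; lra. }
      assert (0 <= INR n ^ c' j) by apply pow_le, pos_INR.
      rewrite Rmult_comm; apply Rmult_le_compat_r; [lra|].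
      rewrite <- (Rmult_1_r (INR n ^ c' j)) at 2; apply Rmult_le_compat_l; assumption.
    - exists K, ((1 + z) / 2); split; [lra|]; intros n; eapply Rle_trans; [|apply (HK n)].
      right; unfold D, combination.
      assert (0 < z ^ n) by (apply pow_lt; lra).
      rewrite <- (Rabs_pos_eq (z ^ n)) at 1 by lra.
      rewrite <- Cmod_RtoC, Rmult_comm, <- Cmod_Cmul, <- sumCn_scal; f_equal.
      apply sumCn_ext; intros; ring. }
  destruct HDgrow as [K [r [Hr HK]]].
  assert (HD : forall n, D (- Z.of_nat n)%Z = C0).
  { intros n; apply Cplx_eq_0; intros pr Hpr; revert n.
    apply (harmonic_zero k p q Hk Hp Hq kq Hkq1 Hkq3 (fun n => pr (D (- Z.of_nat n)%Z)) z Hz Hcontr).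
    - intros i Hi.
      (* With origin [-(i + k)], index [k] is position [-i] and an upward jump leads to
         [-(i + S l)]. *)
      assert (E := gamma_by_parts k p q Hk Hsum
        (fun t => pr (D (- Z.of_nat (i + k) + Z.of_nat t)%Z))); cbv beta in E.
      replace (D (- Z.of_nat i)%Z) with (D (- Z.of_nat (i + k) + Z.of_nat k)%Z) by (f_equal; lia).
      rewrite (sumRn_ext k _ (fun l =>
        p (S l) * pr (D (- Z.of_nat (i + k) + Z.of_nat (k - S l))%Z) +
        q (S l) * pr (D (- Z.of_nat (i + k) + Z.of_nat (k + S l))%Z))).
      + apply Rminus_diag_uniq; rewrite <- E.
        rewrite (sumRn_ext _ _ (fun t =>
          gamma k p q t * pr (D (- Z.of_nat (i + k) + 1 + Z.of_nat t)%Z) -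
          gamma k p q t * pr (D (- Z.of_nat (i + k) + Z.of_nat t)%Z))).
        * rewrite sumRn_minus, <- !(rf_gamma pr) by exact Hpr.
          rewrite <- Hshift; ring.
        * intros t _.
          replace (- Z.of_nat (i + k) + Z.of_nat (S t))%Z
            with (- Z.of_nat (i + k) + 1 + Z.of_nat t)%Z by lia; ring.
      + intros l Hl; f_equal.
        * do 3 f_equal; lia.
        * destruct (Nat.le_gt_cases (S l) kq); [do 3 f_equal; lia|rewrite Hkq3 by lia; ring].
    - intros i Hi; rewrite HDlow by exact Hi; apply rf_C0, Hpr.
    - apply (geometric_cv _ K r Hr); intros n; eapply Rle_trans; [|apply HK].
      assert (0 < z ^ n) by (apply pow_lt; lra).
      rewrite Rabs_mult, (Rabs_pos_eq (z ^ n)) by lra.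
      apply Rmult_le_compat_r; [lra|apply (rf_bound _ Hpr)]. }
  destruct Hv as [j [Hj Hvj]]; apply Hvj.
  apply (CplxAlgebra.polyexp_independent (n := S kq) (Y := Y') (c := c') HY'0); [| |exact Hj].
  - intros [|a] [|a'] Ha Ha'; simpl; intros E1 E2.
    + reflexivity.
    + symmetry in E1; apply HY1 in E1; [contradiction|lia].
    + apply HY1 in E1; [contradiction|lia].
    + assert (kp - 1 + a = kp - 1 + a')%nat by (apply HYinj; auto; lia); lia.
  - intros N; exists (- Z.of_nat N)%Z; intros t Ht; fold (combination (S kq) v Y' c'); fold D.
    change (D (- Z.of_nat N + Z.of_nat t)%Z = C0).
    replace (- Z.of_nat N + Z.of_nat t)%Z with (- Z.of_nat (N - t))%Z by lia; apply HD.
Qed.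

(** * Coefficient vectors and invariant sequences *)

Let d (v : nat -> Cplx) (e : Z) : Cplx := combination kp v Y c e.
(** The last coordinate of [v] is minus the value at 0, matching the entry -1 of the last column of
    [Omega] in its [kp]-th row; the other coordinates are the coefficients of the difference
    sequence. *)
Let xs (v : nat -> Cplx) (n : nat) : Cplx :=
  Cadd (Copp (v kp)) (sumCn n (fun t => d v (Z.of_nat (S t)))).

Lemma small_geometric (v : nat -> Cplx) : exists K r, 0 < r < 1 /\
  forall n, Cmod (d v (Z.of_nat n)) <= K * r ^ n.
Proof.
  set (r := (1 + Cmod (Y (kp - 1)%nat)) / 2).
  assert (H1 : Cmod (Y (kp - 1)%nat) < 1) by (apply small_roots; lia).
  assert (H0 : 0 <= Cmod (Y (kp - 1)%nat)) by apply Cmod_pos.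
  assert (Hr : 0 < r < 1) by (unfold r; lra).
  destruct (combination_geometric_bound kp
    (fun b n => polyexp (Y b) (c b) (Z.of_nat n)) v r) as [K HK]; [lra| |].
  - intros b Hb.
    assert (Cmod (Y b) <= Cmod (Y (kp - 1)%nat)) by (apply HYmono; lia).
    destruct (pow_geometric_bound (c b) (Cmod (Y b)) r) as [K [HK0 HK]].
    + split; [apply Cmod_pos|unfold r; lra].
    + exists K; split; [exact HK0|]; intros n; rewrite Cmod_polyexp_nat; apply HK.
  - exists K, r; split; [exact Hr|exact HK].
Qed.

Definition boundary_conditions (v : nat -> Cplx) : Prop :=
  (forall e : Z, (2 - Z.of_nat kp <= e <= 0)%Z ->
     d v e = if (e =? 0)%Z then Copp (v kp) else C0) /\
  sumCn kq (fun t => Cmul (RtoC (eta kp kq q (kp + t))) (d v (Z.of_nat (S t)))) =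
    Cmul (RtoC (sumR 1 kp p - sumR 1 kq (fun l => INR l * q l))) (Copp (v kp)).

Lemma boundary_invariant (v : nat -> Cplx) (pr : Cplx -> R) :
  boundary_conditions v -> real_functional pr ->
  invariant k p q (fun n => pr (xs v n)) /\
  exists K r, 0 < r < 1 /\ forall n, Rabs (pr (xs v n)) <= K * r ^ n.
Proof.
  intros [Hinit Hlast] Hpr.
  destruct (small_geometric v) as [K [r [Hr HK]]].
  set (dl := fun e => pr (d v e)); set (x0 := pr (Copp (v kp))).
  assert (Hrec : forall e : Z,
    sumRn (2 * k) (fun j => gamma k p q j * dl (e + Z.of_nat j)%Z) = 0).
  { intros e; unfold dl; rewrite <- (rf_gamma pr) by exact Hpr.
    unfold d; rewrite gamma_combination, sumCn_zero; [apply rf_C0, Hpr|].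
    intros b Hb; rewrite HYrec by lia; ring. }
  assert (Hinit' : forall e : Z, (2 - Z.of_nat kp <= e <= 0)%Z ->
    dl e = if (e =? 0)%Z then x0 else 0).
  { intros e He; unfold dl; rewrite Hinit by exact He.
    destruct (e =? 0)%Z; [reflexivity|apply rf_C0, Hpr]. }
  assert (Hlast' : sumRn kq (fun t => eta kp kq q (kp + t) * dl (Z.of_nat (S t))) =
    x0 * (sumR 1 kp p - sumR 1 kq (fun l => INR l * q l))).
  { apply (f_equal pr) in Hlast; rewrite rf_sum, (rf_scal _ Hpr) in Hlast by exact Hpr.
    unfold x0; rewrite Rmult_comm, <- Hlast; apply sumRn_ext; intros.
    symmetry; apply (rf_scal _ Hpr). }
  assert (Hdec : forall n, Rabs (dl (Z.of_nat n)) <= K * r ^ n).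
  { intros n; eapply Rle_trans; [apply (rf_bound _ Hpr)|apply HK]. }
  assert (Hxs : forall n, pr (xs v n) = x0 + sumRn n (fun t => dl (Z.of_nat (S t)))).
  { intros n; unfold xs; rewrite (rf_add _ Hpr), rf_sum by exact Hpr; reflexivity. }
  split.
  - assert (HI := solution_invariant k p q Hk Hsum kq Hkq1 Hkq3 kp Hkp1 Hkp3
      dl x0 Hrec Hinit' Hlast').
    intros j; rewrite Hxs, <- (HI j); apply sumRn_ext; intros; rewrite Hxs; reflexivity.
  - destruct (solution_decay k p q Hk Hsum kq Hkq1 Hkq3 kp Hkp1 Hkp3
      dl x0 K r Hmu Hrec Hinit' Hlast' Hr Hdec) as [K' HK'].
    exists K', r; split; [exact Hr|]; intros n; rewrite Hxs; apply HK'.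
Qed.

Lemma boundary_part_zero (v : nat -> Cplx) (pr : Cplx -> R) :
  boundary_conditions v -> real_functional pr -> pr (xs v O) = 0 ->
  forall n, pr (xs v n) = 0.
Proof.
  intros Hbc Hpr H0; destruct (boundary_invariant v pr Hbc Hpr) as [Hinv [K [r [Hr HK]]]].
  apply (invariant_zero_signed k p q Hk Hp Hq Hsum kq Hkq1 Hkq2
    (fun n => pr (xs v n))); [|exact Hinv|exact H0].
  exact (geometric_cv _ K r Hr HK).
Qed.

(** A sequence starting at 0 vanishes, so its differences vanish on the positive half-line, and the
    columns are independent there. *)
Lemma boundary_trivial (v : nat -> Cplx) :
  boundary_conditions v -> v kp = C0 -> forall b, (b < kp)%nat -> v b = C0.
Proof.
  intros Hbc Hv0.
  assert (Hxs : forall n, xs v n = C0).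
  { intros n; apply Cplx_eq_0; intros pr Hpr; apply boundary_part_zero; [exact Hbc|exact Hpr|].
    unfold xs; simpl; rewrite Hv0; replace (Cadd (Copp C0) C0) with C0 by ring.
    apply rf_C0, Hpr. }
  apply (CplxAlgebra.polyexp_independent (n := kp) (Y := Y) (c := c)).
  - intros b Hb; apply HY0; lia.
  - intros b b' Hb Hb'; apply HYinj; lia.
  - intros N; exists 1%Z; intros t _.
    change (d v (1 + Z.of_nat t)%Z = C0).
    replace (1 + Z.of_nat t)%Z with (Z.of_nat (S t)) by lia.
    assert (H1 := Hxs (S t)); assert (H2 := Hxs t); unfold xs in H1, H2; cbn [sumCn] in H1.
    rewrite Cadd_assoc, H2, Cadd_0_l in H1; exact H1.
Qed.

(** * Rows and determinants of [Omega] *)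

Variables (s : nat) (y : nat -> Cplx) (rr : nat -> nat).
Hypothesis HPsi : forall i b, (b < kp)%nat ->
  Psi kp s y rr i b = polyexp (Y b) (c b) (Z.of_nat i + 1 - Z.of_nat kp).

Let Om (i : nat) : nat -> nat -> Cplx := Omega k p q kp kq s y rr i.
Let row (i : nat) (v : nat -> Cplx) (a : nat) : Cplx :=
  sumCn (kp + 1) (fun b => Cmul (Om i a b) (v b)).

Lemma sumC_length (n a b : nat) (f : nat -> Cplx) : (S b - a = n)%nat ->
  sumC a b f = sumCn n (fun t => f (a + t)%nat).
Proof. intros <-; reflexivity. Qed.

Lemma row_split (i : nat) (v : nat -> Cplx) (a : nat) :
  row i v a = Cadd (sumCn kp (fun b => Cmul (Om i a b) (v b))) (Cmul (Om i a kp) (v kp)).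
Proof. unfold row; rewrite Nat.add_1_r; reflexivity. Qed.

Lemma combine_columns (n : nat) (w : nat -> Cplx) (v : nat -> Cplx) (m : nat -> nat) :
  sumCn kp (fun b => Cmul (sumCn n (fun t => Cmul (w t) (Psi kp s y rr (m t) b))) (v b)) =
  sumCn n (fun t => Cmul (w t) (d v (Z.of_nat (m t) + 1 - Z.of_nat kp))).
Proof.
  rewrite (sumCn_ext kp _ (fun b => sumCn n (fun t =>
    Cmul (w t) (Cmul (v b) (Psi kp s y rr (m t) b))))).
  - rewrite sumCn_exchange; apply sumCn_ext; intros t _; rewrite sumCn_scal; f_equal.
    apply sumCn_ext; intros b Hb; rewrite HPsi by exact Hb; reflexivity.
  - intros b _; rewrite Cmul_comm, <- sumCn_scal; apply sumCn_ext; intros; ring.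
Qed.

Lemma row_top (i : nat) (v : nat -> Cplx) (a : nat) : (a + 1 < kp)%nat ->
  row i v a = Cadd (d v (Z.of_nat a + 2 - Z.of_nat kp))
                   (if (a + 2 =? kp)%nat then v kp else C0).
Proof.
  intros Ha; rewrite row_split; unfold Om, Omega; cbv zeta.
  destruct (Nat.ltb_spec a kp); [|lia].
  destruct (Nat.ltb_spec kp kp); [lia|].
  destruct (Nat.ltb_spec (a + 1) kp); [|lia]; f_equal.
  - replace (Z.of_nat a + 2 - Z.of_nat kp)%Z with (Z.of_nat (a + 1) + 1 - Z.of_nat kp)%Z by lia.
    apply sumCn_ext; intros b Hb; destruct (Nat.ltb_spec b kp); [|lia].
    rewrite HPsi by exact Hb; ring.
  - destruct (Nat.eqb_spec (a + 1) kp); [lia|].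
    destruct (_ =? _)%nat; ring.
Qed.

Lemma row_middle (i : nat) (v : nat -> Cplx) : row i v (kp - 1) = xs v i.
Proof.
  rewrite row_split; unfold Om, Omega; cbv zeta.
  destruct (Nat.ltb_spec (kp - 1) kp); [|lia].
  destruct (Nat.ltb_spec kp kp); [lia|].
  destruct (Nat.ltb_spec (kp - 1 + 1) kp); [lia|].
  destruct (Nat.eqb_spec (kp - 1 + 2) kp); [lia|].
  destruct (Nat.eqb_spec (kp - 1 + 1) kp); [|lia].
  unfold xs; rewrite Cadd_comm; f_equal; [ring|].
  rewrite (sumCn_ext kp _ (fun b => Cmul
    (sumCn i (fun t => Cmul C1 (Psi kp s y rr (kp + t)%nat b))) (v b))).
  - rewrite (combine_columns i (fun _ => C1)); apply sumCn_ext; intros t _.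
    rewrite Cmul_1_l; f_equal; lia.
  - intros b Hb; destruct (Nat.ltb_spec b kp); [|lia].
    rewrite (sumC_length i) by lia; f_equal; apply sumCn_ext; intros; ring.
Qed.

Lemma row_bottom (i : nat) (v : nat -> Cplx) : row i v kp =
  Cadd (sumCn kq (fun t => Cmul (RtoC (eta kp kq q (kp + t))) (d v (Z.of_nat (S t)))))
    (Cmul (RtoC (sumR 1 kp p - sumR 1 kq (fun l => INR l * q l))) (v kp)).
Proof.
  rewrite row_split; unfold Om, Omega; cbv zeta.
  destruct (Nat.ltb_spec kp kp); [lia|]; f_equal.
  rewrite (sumCn_ext kp _ (fun b => Cmul (sumCn kq (fun t =>
    Cmul (RtoC (eta kp kq q (kp + t))) (Psi kp s y rr (kp + t)%nat b))) (v b))).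
  - rewrite (combine_columns kq (fun t => RtoC (eta kp kq q (kp + t)))).
    apply sumCn_ext; intros t _; do 2 f_equal; lia.
  - intros b Hb; destruct (Nat.ltb_spec b kp); [|lia].
    rewrite (sumC_length kq) by lia; reflexivity.
Qed.

Lemma Omega_row_constant (i i' a b : nat) : a <> (kp - 1)%nat -> Om i a b = Om i' a b.
Proof.
  intros Ha; unfold Om, Omega; cbv zeta.
  destruct (Nat.ltb_spec a kp); [|reflexivity].
  destruct (Nat.ltb_spec (a + 1) kp); [reflexivity|lia].
Qed.

Lemma rows_boundary (i : nat) (v : nat -> Cplx) :
  (forall a, (a < kp + 1)%nat -> a <> (kp - 1)%nat -> row i v a = C0) ->
  boundary_conditions v.
Proof.
  intros H; split.
  (* Row [a] speaks of position [e = a + 2 - kp]; the entry 1 of the last column, at [a + 2 = kp],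
     belongs to position 0. *)
  - intros e He; set (a := Z.to_nat (e + Z.of_nat kp - 2)).
    assert (E := H a ltac:(lia) ltac:(lia)); rewrite row_top in E by lia.
    replace (Z.of_nat a + 2 - Z.of_nat kp)%Z with e in E by lia.
    replace (a + 2 =? kp)%nat with (e =? 0)%Z in E.
    + destruct (e =? 0)%Z.
      * replace (d v e) with (Cadd (Cadd (d v e) (v kp)) (Copp (v kp))) by ring; rewrite E; ring.
      * rewrite <- E; ring.
    + destruct (Z.eqb_spec e 0), (Nat.eqb_spec (a + 2) kp); try lia; reflexivity.
  - assert (E := H kp ltac:(lia) ltac:(lia)); rewrite row_bottom in E.
    set (u := sumCn kq _) in *; set (w := RtoC _) in *.
    replace u with (Cadd (Cadd u (Cmul w (v kp))) (Cmul w (Copp (v kp)))) by ring.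
    rewrite E; ring.
Qed.

Let det (i : nat) : Cplx := detC (kp + 1) (Om i).

(** The [kp]-th row of [Omega 0] has an empty sum in the [Psi] part and forces the last coordinate
    of a kernel vector to be 0; the other rows are the boundary conditions, so the vector is 0. *)
Lemma det_Omega_0 : det 0 <> C0.
Proof.
  intros H; destruct (CplxAlgebra.det_eq0_kernel H) as [v [[j [Hj Hvj]] Hker]].
  assert (Hv0 : v kp = C0).
  { assert (E := Hker (kp - 1)%nat ltac:(lia)); fold (row 0 v (kp - 1)) in E.
    rewrite row_middle in E; unfold xs in E; simpl in E.
    replace (v kp) with (Copp (Cadd (Copp (v kp)) C0)) by ring; rewrite E; ring. }
  apply Hvj; destruct (Nat.eq_dec j kp) as [->|Hjk]; [exact Hv0|].
  apply boundary_trivial; [|exact Hv0|lia].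
  apply (rows_boundary 0); intros a Ha _; apply Hker, Ha.
Qed.

Lemma stationary_determinants : exists rho : nat -> R,
  (forall n, 0 <= rho n) /\ rho O = 1 /\ invariant k p q rho /\
  (exists K r, 0 < r < 1 /\ forall n, Rabs (rho n) <= K * r ^ n) /\
  forall i, det i = Cmul (RtoC (rho i)) (det 0).
Proof.
  (* The right-hand side is the unit vector at the row that evaluates the sequence, so it prescribes
     the value 1 at state 0. *)
  destruct (CplxAlgebra.det_neq0_solve (fun a => if (a =? kp - 1)%nat then C1 else C0) det_Omega_0)
    as [v Hv].
  assert (Hbc : boundary_conditions v).
  { apply (rows_boundary 0); intros a Ha Hne; unfold row; rewrite Hv by exact Ha.
    destruct (Nat.eqb_spec a (kp - 1)); [contradiction|reflexivity]. }
  assert (Hx0 : xs v O = C1).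
  { rewrite <- (row_middle 0); unfold row; rewrite Hv, Nat.eqb_refl by lia; reflexivity. }
  destruct (boundary_invariant v fst Hbc rf_fst) as [Hinv [K [r [Hr HK]]]].
  assert (Hcv := geometric_cv _ K r Hr HK).
  assert (Him : forall n, snd (xs v n) = 0).
  { apply boundary_part_zero; [exact Hbc|exact rf_snd|rewrite Hx0; reflexivity]. }
  assert (Hxr : forall n, xs v n = RtoC (fst (xs v n))).
  { intros n; specialize (Him n); destruct (xs v n) as [a b]; simpl in *.
    rewrite Him; reflexivity. }
  (* [x - |x|] is again invariant, tends to 0 and vanishes at state 0, hence [x = |x|]. *)
  assert (Habs : forall n, fst (xs v n) + -1 * Rabs (fst (xs v n)) = 0).
  { apply (invariant_zero_signed k p q Hk Hp Hq Hsum kq Hkq1 Hkq2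
      (fun n => fst (xs v n) + -1 * Rabs (fst (xs v n)))).
    - apply (geometric_cv _ (2 * K) r Hr); intros n; specialize (HK n).
      eapply Rle_trans; [apply Rabs_triang|].
      rewrite Rabs_mult, Rabs_Rabsolu, (Rabs_left (-1)) by lra; lra.
    - apply (invariant_linear k p q); [exact Hinv|].
      apply (invariant_abs k p q Hk Hp Hq Hsum); assumption.
    - rewrite Hx0; simpl; rewrite Rabs_R1; ring. }
  exists (fun n => fst (xs v n)); split; [|split; [|split; [|split]]].
  - intros n; specialize (Habs n); pose proof (Rabs_pos (fst (xs v n))); lra.
  - rewrite Hx0; reflexivity.
  - exact Hinv.
  - exists K, r; split; assumption.
  - intros i; rewrite <- Hxr, <- (Cmul_1_l (det i)).
    (* [Omega i] and [Omega 0] differ in one row only, and on the same [v] that row takes the values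
       [xs v i] and 1. *)
    apply (CplxAlgebra.det_replace_row (r := (kp - 1)%nat) (v := v)).
    + lia.
    + exists kp; split; [lia|]; intros E; unfold xs in Hx0; rewrite E in Hx0; simpl in Hx0.
      apply C1_neq_C0; rewrite <- Hx0; ring.
    + intros a b Ha; apply Omega_row_constant, Ha.
    + intros a Ha; fold (row i v a); destruct (Nat.eqb_spec a (kp - 1)) as [->|Hne].
      * apply row_middle.
      * transitivity (row 0 v a).
        -- apply sumCn_ext; intros b _; rewrite (Omega_row_constant i 0) by exact Hne; reflexivity.
        -- unfold row; rewrite Hv by exact Ha.
           destruct (Nat.eqb_spec a (kp - 1)); [contradiction|reflexivity].
    + exact Hv.
Qed.
End Spectrum.

(** * Columns of [Psi] from the listed roots *)

Section Roots.
Variables (s : nat) (y : nat -> Cplx) (rr : nat -> nat).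
Hypothesis Hroots : root_listing k p q s y rr.

Let Yc (b : nat) : Cplx := y (fst (locate rr s 0 b)).
Let cc (b : nat) : nat := snd (locate rr s 0 b).

Lemma psi_sum (z : Cplx) : psi k p q z = sumCn (2 * k) (fun j => Cmul (ga j) (Cpow z j)).
Proof.
  unfold psi, sumC; replace (S (2 * k - 1) - 0)%nat with (2 * k)%nat by lia; reflexivity.
Qed.

(** The lowest and highest nonzero coefficients of [psi] have indices [k - kp] and [k + kq - 1]. *)
Lemma sum_rr : sumNn s rr = (kp + kq - 1)%nat.
Proof.
  destruct Hroots as [Hy0 [_ [_ [_ [a [m [Ha Hfact]]]]]]].
  assert (Hg : forall j, ga j = C0 <-> gamma k p q j = 0).
  { intros j; unfold ga, RtoC, C0; split; [intros H; injection H; auto|intros ->; reflexivity]. }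
  assert (E : (sumNn s rr + (k - kp) = k + kq - 1)%nat); [|lia].
  apply (CplxAlgebra.sum_multiplicities (n := (2 * k)%nat) (g := ga) (y := y) (c := a) (m := m)).
  - intros z; rewrite <- psi_sum; apply Hfact.
  - exact Ha.
  - exact Hy0.
  - lia.
  - lia.
  - rewrite Hg; exact gamma_trailing_neq0.
  - rewrite Hg; exact gamma_leading_neq0.
  - intros j Hj; apply Hg, (gamma_trailing k p q Hk kq Hkq1 kp Hkp1 Hkp3), Hj.
  - intros j Hj; apply Hg, (gamma_leading k p q Hk kq Hkq1 Hkq3), Hj.
Qed.

Lemma locate_columns (b : nat) : (b < kp + kq - 1)%nat ->
  (fst (locate rr s 0 b) < s)%nat /\ (cc b < rr (fst (locate rr s 0 b)))%nat /\
  forall i, Psi kp s y rr i b = polyexp (Yc b) (cc b) (Z.of_nat i + 1 - Z.of_nat kp).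
Proof.
  intros Hb; destruct (locate_spec rr s 0 b) as [H1 [H2 H3]].
  - rewrite (sumNn_ext s _ rr), sum_rr by reflexivity; exact Hb.
  - split; [exact H1|]; split; [exact H2|]; intros i; apply H3.
Qed.

Lemma root_recurrence (j b : nat) (e : Z) : (j < s)%nat -> (b < rr j)%nat ->
  sumCn (2 * k) (fun t => Cmul (ga t) (polyexp (y j) b (e + Z.of_nat t))) = C0.
Proof.
  intros Hj Hb; destruct Hroots as [Hy0 [_ [_ [_ [a [m [Ha Hfact]]]]]]].
  apply (CplxAlgebra.polyexp_recurrence (s := s) (y := y) (rr := rr) (c := a) (m := m)); auto.
  intros z; rewrite <- psi_sum; apply Hfact.
Qed.

Lemma root_neq_1 (j : nat) : (j < s)%nat -> y j <> C1.
Proof.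
  intros Hj E.
  assert (Hrj : (1 <= rr j)%nat) by (apply Hroots; exact Hj).
  assert (H := root_recurrence j 0 0 Hj Hrj).
  apply (f_equal fst) in H; rewrite (rf_gamma fst) in H by exact rf_fst.
  rewrite (sumRn_ext _ _ (gamma k p q)), gamma_sum in H.
  - simpl in H; lra.
  - exact Hk.
  - exact Hsum.
  - intros t _; rewrite E, polyexp_C1; simpl; ring.
Qed.

Lemma listed_determinants : exists rho : nat -> R,
  (forall n, 0 <= rho n) /\ rho O = 1 /\ invariant k p q rho /\
  (exists K r, 0 < r < 1 /\ forall n, Rabs (rho n) <= K * r ^ n) /\
  detC (kp + 1) (Omega k p q kp kq s y rr 0) <> C0 /\
  forall i, detC (kp + 1) (Omega k p q kp kq s y rr i) =
    Cmul (RtoC (rho i)) (detC (kp + 1) (Omega k p q kp kq s y rr 0)).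
Proof.
  assert (HY0 : forall b, (b < kp + kq - 1)%nat -> Yc b <> C0).
  { intros b Hb; apply Hroots, locate_columns, Hb. }
  assert (HY1 : forall b, (b < kp + kq - 1)%nat -> Yc b <> C1).
  { intros b Hb; apply root_neq_1, locate_columns, Hb. }
  assert (Hinj : forall b b', (b < kp + kq - 1)%nat -> (b' < kp + kq - 1)%nat ->
    Yc b = Yc b' -> cc b = cc b' -> b = b').
  { intros b b' Hb Hb' E1 E2; apply (locate_inj rr s 0).
    apply injective_projections; [|exact E2].
    destruct (Nat.eq_dec (fst (locate rr s 0 b)) (fst (locate rr s 0 b'))) as [|Hne]; [assumption|].
    exfalso; destruct Hroots as [_ [_ [Hd _]]]; revert E1; apply Hd; [| |exact Hne];
      apply locate_columns; assumption. }
  assert (Hmono : forall b b', (b <= b')%nat -> (b' < kp + kq - 1)%nat ->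
    Cmod (Yc b) <= Cmod (Yc b')).
  { intros b b' H Hb'; apply Hroots; [apply locate_mono, H|apply locate_columns, Hb']. }
  assert (Hrec : forall b e, (b < kp + kq - 1)%nat ->
    sumCn (2 * k) (fun t => Cmul (ga t) (polyexp (Yc b) (cc b) (e + Z.of_nat t))) = C0).
  { intros b e Hb; apply root_recurrence; apply locate_columns, Hb. }
  assert (HPsi : forall i b, (b < kp)%nat ->
    Psi kp s y rr i b = polyexp (Yc b) (cc b) (Z.of_nat i + 1 - Z.of_nat kp)).
  { intros i b Hb; apply locate_columns; lia. }
  destruct (stationary_determinants Yc cc HY0 HY1 Hinj Hmono Hrec s y rr HPsi)
    as [rho [H1 [H2 [H3 [H4 H5]]]]].
  exists rho; repeat (split; [assumption|]); split; [|exact H5].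
  exact (det_Omega_0 Yc cc HY0 HY1 Hinj Hmono Hrec s y rr HPsi).
Qed.
End Roots.
End Leap.

(** * Infinite sums and the stationary distribution *)

Lemma infinite_sum_terms (x : nat -> R) (l : R) : infinite_sum x l -> Un_cv x 0.
Proof.
  intros H; apply is_lim_seq_Reals, ex_series_lim_0.
  exists l; apply is_series_Reals, H.
Qed.

Lemma infinite_sum_scal (x : nat -> R) (a l : R) :
  infinite_sum x l -> infinite_sum (fun i => a * x i) (a * l).
Proof.
  intros H; apply is_series_Reals.
  apply (is_series_scal (K := R_AbsRing) (V := R_NormedModule) a x l).
  apply is_series_Reals, H.
Qed.

Lemma infinite_sum_geometric (x : nat -> R) (K r : R) : 0 < r < 1 ->
  (forall n, Rabs (x n) <= K * r ^ n) -> exists l, infinite_sum x l.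
Proof.
  intros Hr H.
  assert (Hex : ex_series x).
  { apply (ex_series_le (K := R_AbsRing) (V := R_CompleteNormedModule) x (fun n => K * r ^ n)).
    - exact H.
    - apply (ex_series_scal (K := R_AbsRing) (V := R_NormedModule) K).
      apply ex_series_geom; rewrite Rabs_pos_eq; lra. }
  destruct Hex as [l Hl]; exists l; apply is_series_Reals, Hl.
Qed.

Theorem mainTheorem8 (k : nat) (p q : nat -> R) (kp kq : nat)
  (Hk : (1 <= k)%nat)
  (Hp : forall j, (1 <= j <= k)%nat -> 0 <= p j)
  (Hq : forall j, (1 <= j <= k)%nat -> 0 <= q j)
  (Hsum : sumR 1 k (fun j => p j + q j) = 1)
  (Hpsum : 0 < sumR 1 k p)
  (Hqsum : 0 < sumR 1 k q)
  (Hgcd : forall d : nat,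
     (forall j, (1 <= j <= k)%nat -> 0 < p j + q j -> Nat.divide d j) -> d = 1%nat)
  (Hkp : is_last_pos k p kp)
  (Hkq : is_last_pos k q kq) :
  (0 <= drift k p q -> ~ exists pi : nat -> R, stationary k p q pi) /\
  (drift k p q < 0 ->
     forall (s : nat) (y : nat -> Cplx) (rr : nat -> nat),
       root_listing k p q s y rr ->
       exists L : Cplx, L <> C0 /\
         Cseries_cv (fun j => detC (kp + 1) (Omega k p q kp kq s y rr j)) L /\
         (exists pi : nat -> R, stationary k p q pi) /\
         (forall pi : nat -> R, stationary k p q pi ->
            forall i : nat, RtoC (pi i) = Cdiv (detC (kp + 1) (Omega k p q kp kq s y rr i)) L)).
Proof.
  rewrite sumR_1 in Hsum, Hpsum; clear Hqsum Hgcd.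
  destruct Hkp as [Hkp1 [Hkp2 Hkp3]], Hkq as [Hkq1 [Hkq2 Hkq3]].
  assert (Hpz : forall j, (kp < j <= k)%nat -> p j = 0).
  { intros j Hj; specialize (Hkp3 j Hj); specialize (Hp j ltac:(lia)); lra. }
  assert (Hqz : forall j, (kq < j <= k)%nat -> q j = 0).
  { intros j Hj; specialize (Hkq3 j Hj); specialize (Hq j ltac:(lia)); lra. }
  split.
  - intros Hmu [pi [Hpos [Hone Hinv]]].
    apply (invariant_infinite_sum k p q Hk) in Hinv.
    assert (Hz : forall i, pi i = 0).
    { apply (invariant_zero_of_drift k p q Hk Hp Hq Hsum kq Hkq1 Hkq2 pi Hpsum Hmu Hpos).
      - exact (infinite_sum_terms pi 1 Hone).
      - exact Hinv. }
    assert (H0 : infinite_sum pi (sumRn 0 pi)) by (apply infinite_sum_finite; intros; apply Hz).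
    assert (E := uniqueness_sum _ _ _ Hone H0); simpl in E; lra.
  - intros Hmu s y rr Hroots.
    destruct (listed_determinants k p q kp kq Hk Hp Hq Hsum Hkp1 Hkp2 Hpz Hkq1 Hkq2 Hqz Hmu
      s y rr Hroots) as [rho [Hpos [Hrho0 [Hinv [[K [r [Hr HK]]] [Hdet0 Hdet]]]]]].
    set (D0 := detC (kp + 1) (Omega k p q kp kq s y rr 0)) in *.
    destruct (infinite_sum_geometric rho K r Hr HK) as [T HT].
    assert (HT1 : 1 <= T).
    { rewrite <- Hrho0; apply (sum_incr rho 0 T HT Hpos). }
    (* Each determinant is [rho j * D0], so the series sums to [T * D0], nonzero as
       [T >= rho 0 = 1]. *)
    exists (Cmul (RtoC T) D0); split; [|split; [|split]].
    + apply Cmul_neq_0; [|exact Hdet0].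
      unfold RtoC, C0; intros H; injection H; lra.
    + intros eps Heps.
      assert (HD : 0 < Cmod D0) by (apply Cmod_gt_0; exact Hdet0).
      destruct (HT (eps / Cmod D0)) as [N HN]; [apply Rdiv_lt_0_compat; assumption|].
      exists N; intros n Hn; specialize (HN n Hn).
      rewrite sum_f_R0_sumRn in HN; unfold Rdist in HN.
      replace (Csub _ _) with (Cmul (RtoC (sumRn (S n) rho - T)) D0).
      * rewrite Cmod_Cmul, Cmod_RtoC.
        apply (Rmult_lt_compat_r (Cmod D0)) in HN; [|exact HD].
        replace (eps / Cmod D0 * Cmod D0) with eps in HN by (field; lra); exact HN.
      * rewrite (sumCn_ext (S n) _ (fun j => Cmul D0 (RtoC (rho j)))).
        -- rewrite sumCn_scal.
           replace (sumCn (S n) (fun j => RtoC (rho j))) with (RtoC (sumRn (S n) rho)).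
           ++ replace (RtoC (sumRn (S n) rho - T)) with (Csub (RtoC (sumRn (S n) rho)) (RtoC T)).
              ** ring.
              ** unfold Csub, Cadd, Copp, RtoC; simpl; f_equal; ring.
           ++ generalize (S n); intros m; induction m as [|m IH]; [reflexivity|].
              cbn [sumCn sumRn]; rewrite <- IH.
              unfold Cadd, RtoC; simpl; f_equal; ring.
        -- intros j _; rewrite Hdet; ring.
    + exists (fun i => / T * rho i); split; [|split].
      * intros i; apply Rmult_le_pos; [left; apply Rinv_0_lt_compat; lra|apply Hpos].
      * replace 1 with (/ T * T) by (field; lra); apply infinite_sum_scal, HT.
      * apply (invariant_infinite_sum k p q Hk); intros j.
        rewrite <- (Hinv j), <- sumRn_scal; apply sumRn_ext; intros; ring.
    + intros pi [Hpi [Hone Hst]] i.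
      apply (invariant_infinite_sum k p q Hk) in Hst.
      (* Any stationary [pi] is a multiple of [rho]: the difference with equal values at 0 is
         invariant and tends to 0. Total mass 1 then fixes [pi O] as [/ T]. *)
      assert (Hprop : forall n, pi n + - pi O * rho n = 0).
      { apply (invariant_zero_signed k p q Hk Hp Hq Hsum kq Hkq1 Hkq2
          (fun n => pi n + - pi O * rho n)).
        - replace 0 with (0 + - pi O * 0) by ring.
          apply (CV_plus pi (fun n => - pi O * rho n)).
          + exact (infinite_sum_terms pi 1 Hone).
          + rewrite Rmult_0_r; apply infinite_sum_terms with (- pi O * T).
            apply infinite_sum_scal, HT.
        - apply (invariant_linear k p q); assumption.
        - rewrite Hrho0; ring. }
      assert (Hpi0 : pi O * T = 1).
      { apply (uniqueness_sum (fun n => pi O * rho n)); [apply infinite_sum_scal, HT|].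
        intros eps Heps; destruct (Hone eps Heps) as [N HN]; exists N; intros n Hn.
        rewrite (sum_eq _ pi); [apply HN, Hn|].
        intros m _; specialize (Hprop m); lra. }
      assert (HTC : RtoC T <> C0) by (unfold RtoC, C0; intros H; injection H; lra).
      assert (Hpii : RtoC (rho i) = Cmul (RtoC (pi i)) (RtoC T)).
      { rewrite Cmul_RtoC; f_equal; specialize (Hprop i).
        replace (pi i) with (pi O * rho i) by lra.
        replace (pi O * rho i * T) with (pi O * T * rho i) by ring; rewrite Hpi0; ring. }
      rewrite Hdet, Hpii; unfold Cdiv.
      set (L := Cmul (RtoC T) D0).
      replace (Cmul (Cmul (Cmul (RtoC (pi i)) (RtoC T)) D0) (Cinv L))
        with (Cmul (RtoC (pi i)) (Cmul (Cinv L) L)) by (unfold L; ring).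
      rewrite Cinv_l; [ring|apply Cmul_neq_0; assumption].
Qed.
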